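(* Let $d\geq 3$ and $\beta>0$, and set $f_d(\beta)=(d-2)\beta^2+(2d-3)\beta$. Then there exists $\boldsymbol\alpha\in\pi_d$ such that: (i) for every $\mathbf z\in\mathbb Z^d$ which is a best approximation vector for $L_{\boldsymbol\alpha}$ we have $|L_{\boldsymbol\alpha}(\mathbf z)|\cdot|\mathbf z|^{d-1}\asymp|\mathbf z|^{-f_d(\beta)}$; (ii) for every $\mathbf z\in\mathbb Z^d$ which is not an integer multiple of a best approximation vector for $L_{\boldsymbol\alpha}$ we have $|L_{\boldsymbol\alpha}(\mathbf z)|\cdot|\mathbf z|^{d-1}\gg|\mathbf z|^{-f_d(\beta)+(d-1)\beta}$; (iii) the set of asymptotic directions for best approximation vectors for $L_{\boldsymbol\alpha}$ consists of exactly two pairs $\pm\mathbf u_1,\pm\mathbf u_2$ of points. The constants implied by $\asymp$ and $\gg$ depend only on $d$, $\beta$ and $\boldsymbol\alpha$.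
   Context: $|\cdot|$ is the Euclidean norm and $\langle\cdot,\cdot\rangle$ the standard inner product. For $\mathbf x=(x_1,\dots,x_d)\in\mathbb R^d$ write $\underline{\mathbf x}=(x_1,\dots,x_{d-1})$. Let $\pi_d=\{\mathbf x\in\mathbb R^d: x_d=1\}$ and, for $\boldsymbol\alpha=(\alpha_1,\dots,\alpha_{d-1},1)\in\pi_d$, $L_{\boldsymbol\alpha}(\mathbf x)=\langle\boldsymbol\alpha,\mathbf x\rangle=\alpha_1x_1+\dots+\alpha_{d-1}x_{d-1}+x_d$. A vector $\mathbf z\in\mathbb Z^d$ with $\underline{\mathbf z}\neq0$ is a best approximation vector for $L_{\boldsymbol\alpha}$ if $|L_{\boldsymbol\alpha}(\mathbf z)|\leq|L_{\boldsymbol\alpha}(\mathbf z')|$ for every $\mathbf z'\in\mathbb Z^d$ with $0<|\underline{\mathbf z'}|\leq|\underline{\mathbf z}|$, with strict inequality whenever $0<|\underline{\mathbf z'}|<|\underline{\mathbf z}|$. A unit vector $\mathbf u\in\mathbb R^d$ is an asymptotic direction for best approximation vectors for $L_{\boldsymbol\alpha}$ if it is an accumulation point of the set $\{\mathbf z/|\mathbf z|:\mathbf z\text{ a best approximation vector for }L_{\boldsymbol\alpha}\}$ (this set of directions is symmetric under $\mathbf u\mapsto-\mathbf u$). *)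

(* Defs.v *)
From Stdlib Require Import Reals Lra ZArith.
Open Scope R_scope.

(* Vectors of R^d / Z^d are represented as functions on nat; only the
   coordinates 0 .. d-1 are ever used (coordinate i <-> x_(i+1)). *)
Definition rvec := nat -> R.
Definition zvec := nat -> Z.

Fixpoint rsum (n : nat) (f : nat -> R) : R :=
  match n with
  | O => 0
  | S m => rsum m f + f m
  end.

Definition rnorm (n : nat) (x : rvec) : R := sqrt (rsum n (fun i => x i * x i)).

Definition zR (z : zvec) : rvec := fun i => IZR (z i).

Definition znorm (d : nat) (z : zvec) : R := rnorm d (zR z).

Definition znorm_under (d : nat) (z : zvec) : R := rnorm (d - 1) (zR z).

Definition in_pi (d : nat) (alpha : rvec) : Prop := alpha (d - 1)%nat = 1.

Definition Lform (d : nat) (alpha : rvec) (z : zvec) : R :=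
  rsum d (fun i => alpha i * IZR (z i)).

Definition best_approx (d : nat) (alpha : rvec) (z : zvec) : Prop :=
  znorm_under d z <> 0 /\
  (forall z' : zvec, 0 < znorm_under d z' <= znorm_under d z ->
      Rabs (Lform d alpha z) <= Rabs (Lform d alpha z')) /\
  (forall z' : zvec, 0 < znorm_under d z' < znorm_under d z ->
      Rabs (Lform d alpha z) < Rabs (Lform d alpha z')).

Definition veq (d : nat) (u v : rvec) : Prop := forall i, (i < d)%nat -> u i = v i.
Definition zveq (d : nat) (u v : zvec) : Prop := forall i, (i < d)%nat -> u i = v i.

Definition vopp (u : rvec) : rvec := fun i => - u i.
Definition vsub (u v : rvec) : rvec := fun i => u i - v i.

Definition zdir (d : nat) (z : zvec) : rvec := fun i => IZR (z i) / znorm d z.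

Definition multiple_of_best (d : nat) (alpha : rvec) (z : zvec) : Prop :=
  exists (k : Z) (b : zvec), best_approx d alpha b /\
    zveq d z (fun i => (k * b i)%Z).

Definition asymptotic_direction (d : nat) (alpha : rvec) (u : rvec) : Prop :=
  rnorm d u = 1 /\
  forall eps : R, 0 < eps ->
    exists z : zvec, best_approx d alpha z /\
      ~ veq d (zdir d z) u /\ rnorm d (vsub (zdir d z) u) < eps.

Definition f_d (d : nat) (beta : R) : R :=
  (INR d - 2) * beta ^ 2 + (2 * INR d - 3) * beta.

(* Main.v *)
(* Write d = n + 3 and t = 1 + beta.  Choose integers p_0 = p_1 = 1, p_{k+1} = p_k r_k with p_{k+1} of
   order p_k^t, and build unimodular bases of Z^d
     v_k, w_1, ..., w_n, v_{k+1}, v_{k+2},      |v_{k+1}| ~ p_k,   |w_i| ~ |v_{k+2}| ~ p_{k+1},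
   by w_i' = r_{k+1} w_i - w_{i-1} (with w_0 = v_k) and v_{k+3} = r_k r_{k+1} v_{k+1} + K v_{k+2} + w_n.
   Up to small relative errors every vector is a large multiple of an older one, so the directions of the
   w_i and of the v_k with k of given parity converge, to d - 1 independent limits.  The linear forms whose
   values on all these bases are dominated by the value at v_k and have suitable alternating signs form a
   decreasing sequence of nonempty compact sets, hence there is a common one, and the recursion forces
   |L(v_k)| ~ 1 / (p_k p_{k+1}^{d-2}).  Since L(w_i) is far larger than L(v_{k+1}), only combinations of
   v_{k+1} and v_{k+2} compete for being best approximations in the range |v_{k+1}| <= |z| <= |v_{k+2}|; as L
   changes sign from v_{k+1} to v_{k+2} while their inner product is nonnegative, only the two vectors
   themselves remain. *)
Require Import Defs.
From Stdlib Require Import Reals ZArith Lra Lia Psatz Classical IndefiniteDescription.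
Open Scope R_scope.

(** Since p_{k+2} = p_k r_k r_{k+1}, the coefficient r_k r_{k+1} carries v_{k+1} to size p_{k+2}
    without turning it. The summand K v_{k+2} serves the inner products: it adds K |v_{k+2}|^2 to
    the product of v_{k+2} with v_{k+3} and outweighs the product with w_n, whose sign is not
    controlled; K = 16 d suffices. Its price is a relative error of order K / r_{k+1}, in directions
    and in values alike. These errors must be summable for every beta, whence r_{k+1} >= M 2^k, and
    their sum must stay below a small multiple of 1/d, whence M >= 1000 d^2: then the last d - 1
    basis vectors, cut to their first d - 1 coordinates, form a nearly diagonal matrix, and a bound
    on |z| becomes a bound on the integer coefficients of z. The order of L(v_k) reflects a
    determinant: with the last coordinate replaced by L the basis still has determinant 1 or -1, and
    the main term is L(v_k) times the product p_k p_{k+1}^{d-2} of the sizes of the other vectors.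
    The proof reads this off the recursion, along the ladder L(w_{i-1}) ~ r_{k+1} L(w_i). *)

(** * Finite sums and Euclidean norms *)

Lemma rsum_ext (n : nat) (f g : nat -> R) :
  (forall i, (i < n)%nat -> f i = g i) -> rsum n f = rsum n g.
Proof.
  induction n as [|n IH]; intros H; simpl; [reflexivity|].
  rewrite IH, (H n); [reflexivity | lia | intros; apply H; lia].
Qed.

Lemma rsum_le (n : nat) (f g : nat -> R) :
  (forall i, (i < n)%nat -> f i <= g i) -> rsum n f <= rsum n g.
Proof.
  induction n as [|n IH]; intros H; simpl; [lra|].
  apply Rplus_le_compat; [apply IH; intros; apply H; lia | apply H; lia].
Qed.

Lemma rsum_plus (n : nat) (f g : nat -> R) :
  rsum n (fun i => f i + g i) = rsum n f + rsum n g.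
Proof. induction n as [|n IH]; simpl; [lra | rewrite IH; lra]. Qed.

Lemma rsum_scal (n : nat) (a : R) (f : nat -> R) :
  rsum n (fun i => a * f i) = a * rsum n f.
Proof. induction n as [|n IH]; simpl; [lra | rewrite IH; lra]. Qed.

Lemma rsum_const (n : nat) (c : R) : rsum n (fun _ => c) = INR n * c.
Proof. induction n as [|n IH]; [simpl; lra | rewrite S_INR; simpl rsum; rewrite IH; lra]. Qed.

Lemma rsum_le_const (n : nat) (f : nat -> R) (c : R) :
  (forall i, (i < n)%nat -> f i <= c) -> rsum n f <= INR n * c.
Proof. intros H. rewrite <- rsum_const. now apply rsum_le. Qed.

Lemma rsum_nonneg (n : nat) (f : nat -> R) :
  (forall i, (i < n)%nat -> 0 <= f i) -> 0 <= rsum n f.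
Proof.
  intros H. replace 0 with (rsum n (fun _ => 0)); [now apply rsum_le|].
  rewrite rsum_const; lra.
Qed.

Lemma rsum_zero (n : nat) (f : nat -> R) :
  (forall i, (i < n)%nat -> f i = 0) -> rsum n f = 0.
Proof. intros H. rewrite (rsum_ext n f (fun _ => 0) H), rsum_const. lra. Qed.

Lemma rsum_Rabs (n : nat) (f : nat -> R) :
  Rabs (rsum n f) <= rsum n (fun i => Rabs (f i)).
Proof.
  induction n as [|n IH]; simpl; [rewrite Rabs_R0; lra|].
  eapply Rle_trans; [apply Rabs_triang | lra].
Qed.

Lemma rsum_term_le (n : nat) (f : nat -> R) (j : nat) :
  (forall i, (i < n)%nat -> 0 <= f i) -> (j < n)%nat -> f j <= rsum n f.
Proof.
  induction n as [|n IH]; intros H Hj; [lia|]; simpl.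
  destruct (Nat.eq_dec j n) as [->|Hne].
  - assert (0 <= rsum n f) by (apply rsum_nonneg; intros; apply H; lia). lra.
  - assert (f j <= rsum n f) by (apply IH; [intros; apply H; lia | lia]).
    specialize (H n ltac:(lia)). lra.
Qed.

Lemma rsum_single (n : nat) (f : nat -> R) (j : nat) :
  (j < n)%nat -> (forall i, (i < n)%nat -> i <> j -> f i = 0) -> rsum n f = f j.
Proof.
  induction n as [|n IH]; intros Hj H; [lia|]; simpl.
  destruct (Nat.eq_dec j n) as [->|Hne].
  - rewrite rsum_zero; [lra | intros; apply H; lia].
  - rewrite IH, (H n); [lra | lia | lia | lia | intros; apply H; lia].
Qed.

Lemma rsum_swap (n m : nat) (f : nat -> nat -> R) :
  rsum n (fun i => rsum m (fun c => f i c)) = rsum m (fun c => rsum n (fun i => f i c)).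
Proof.
  induction n as [|n IH]; simpl.
  - symmetry; apply rsum_zero; reflexivity.
  - rewrite IH, <- rsum_plus. reflexivity.
Qed.

Lemma rsum_succ_l (n : nat) (f : nat -> R) :
  rsum (S n) f = f O + rsum n (fun i => f (S i)).
Proof.
  induction n as [|n IH]; [simpl; lra|].
  change (rsum (S (S n)) f) with (rsum (S n) f + f (S n)). rewrite IH. simpl. lra.
Qed.

Lemma rnorm_nonneg (n : nat) (x : rvec) : 0 <= rnorm n x.
Proof. apply sqrt_pos. Qed.

Lemma rsum_sqr_nonneg (n : nat) (x : rvec) : 0 <= rsum n (fun i => x i * x i).
Proof. apply rsum_nonneg; intros; nra. Qed.

Lemma rnorm_sqr (n : nat) (x : rvec) : rnorm n x * rnorm n x = rsum n (fun i => x i * x i).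
Proof. apply sqrt_sqrt, rsum_sqr_nonneg. Qed.

Lemma rnorm_ext (n : nat) (x y : rvec) :
  (forall i, (i < n)%nat -> x i = y i) -> rnorm n x = rnorm n y.
Proof. intros H. unfold rnorm. f_equal. apply rsum_ext; intros; now rewrite H. Qed.

Lemma Rabs_le_rnorm (n : nat) (x : rvec) (i : nat) : (i < n)%nat -> Rabs (x i) <= rnorm n x.
Proof.
  intros Hi. rewrite <- sqrt_Rsqr_abs. apply sqrt_le_1_alt. unfold Rsqr.
  apply (rsum_term_le n (fun i => x i * x i)); [intros; nra | exact Hi].
Qed.

Lemma rnorm_le (n : nat) (x : rvec) (c : R) :
  0 <= c -> (forall i, (i < n)%nat -> Rabs (x i) <= c) -> rnorm n x <= INR n * c.
Proof.
  intros Hc H.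
  assert (Hn := pos_INR n).
  rewrite <- (sqrt_Rsqr (INR n * c)) by nra.
  apply sqrt_le_1_alt. unfold Rsqr.
  apply Rle_trans with (INR n * (c * c)).
  - apply rsum_le_const. intros i Hi. specialize (H i Hi).
    assert (H0 := Rabs_pos (x i)).
    assert (x i * x i = Rabs (x i) * Rabs (x i)) by (rewrite <- Rabs_mult, Rabs_pos_eq; nra).
    nra.
  - destruct n as [|n]; [simpl; lra|].
    assert (1 <= INR (S n)) by (rewrite S_INR; assert (H1 := pos_INR n); lra).
    assert (0 <= c * c) by nra. nra.
Qed.

Lemma rnorm_scal (n : nat) (a : R) (x : rvec) :
  rnorm n (fun i => a * x i) = Rabs a * rnorm n x.
Proof.
  unfold rnorm.
  rewrite (rsum_ext n _ (fun i => (a * a) * (x i * x i))) by (intros; ring).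
  rewrite rsum_scal, sqrt_mult by (try apply rsum_sqr_nonneg; nra).
  f_equal. apply sqrt_Rsqr_abs.
Qed.

(** * Limits, subsequences and separation from finitely many vectors *)

Lemma Un_cv_const (a : R) : Un_cv (fun _ => a) a.
Proof. intros e He. exists O. intros. unfold Rdist. rewrite Rminus_diag, Rabs_R0. lra. Qed.

Lemma Un_cv_ext (u v : nat -> R) (l : R) : (forall k, u k = v k) -> Un_cv u l -> Un_cv v l.
Proof. intros H Hu e He. destruct (Hu e He) as [N HN]. exists N. intros k Hk. rewrite <- H. now apply HN. Qed.

Lemma Un_cv_rsum (n : nat) (f : nat -> nat -> R) (g : nat -> R) :
  (forall i, (i < n)%nat -> Un_cv (fun k => f k i) (g i)) ->
  Un_cv (fun k => rsum n (f k)) (rsum n g).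
Proof.
  induction n as [|n IH]; intros H; simpl; [apply Un_cv_const|].
  apply (CV_plus (fun k => rsum n (f k)) (fun k => f k n)); [apply IH; intros; apply H; lia | apply H; lia].
Qed.

Lemma Un_cv_rnorm (n : nat) (f : nat -> rvec) (g : rvec) :
  (forall i, (i < n)%nat -> Un_cv (fun k => f k i) (g i)) ->
  Un_cv (fun k => rnorm n (f k)) (rnorm n g).
Proof.
  intros H. unfold rnorm.
  apply (continuity_seq sqrt (fun k => rsum n (fun i => f k i * f k i))).
  - apply continuity_pt_sqrt, rsum_sqr_nonneg.
  - apply (Un_cv_rsum n (fun k i => f k i * f k i)).
    intros i Hi. apply (CV_mult (fun k => f k i) (fun k => f k i)); now apply H.
Qed.

Lemma Un_cv_div (u v : nat -> R) (l m : R) :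
  m <> 0 -> Un_cv u l -> Un_cv v m -> Un_cv (fun k => u k / v k) (l / m).
Proof.
  intros Hm Hu Hv. apply (CV_mult u (fun k => / v k)); [exact Hu|].
  apply (continuity_seq Rinv v); [|exact Hv].
  apply (continuity_pt_inv (fun x => x)); [apply derivable_continuous_pt, derivable_pt_id | exact Hm].
Qed.

Lemma Un_cv_subseq (u : nat -> R) (l : R) (phi : nat -> nat) :
  (forall N, (N <= phi N)%nat) -> Un_cv u l -> Un_cv (fun N => u (phi N)) l.
Proof.
  intros Hphi Hu e He. destruct (Hu e He) as [N HN]. exists N. intros k Hk.
  apply HN. specialize (Hphi k). lia.
Qed.

(** The bound [N <= phi N] stands in for strict monotonicity: it is enough for limits along the
    subsequence and is stable under composition, as the vector version requires. *)
Lemma bounded_subsequence (u : nat -> R) (C : R) :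
  (forall N, Rabs (u N) <= C) ->
  exists (phi : nat -> nat) (l : R), (forall N, (N <= phi N)%nat) /\ Un_cv (fun N => u (phi N)) l.
Proof.
  intros H.
  destruct (Bolzano_Weierstrass u (fun x => - C <= x <= C) (compact_P3 (- C) C)) as [l Hl].
  { intros N. specialize (H N). revert H. unfold Rabs. destruct (Rcase_abs (u N)); lra. }
  assert (Hex : forall N : nat, exists q : nat, (N <= q)%nat /\ Rabs (u q - l) < / (INR N + 1)).
  { intros N.
    assert (Hpos : 0 < / (INR N + 1)) by (apply Rinv_0_lt_compat; assert (H1 := pos_INR N); lra).
    destruct (Hl (fun y => Rabs (y - l) < / (INR N + 1)) N) as [q Hq].
    - exists (mkposreal _ Hpos). intros y Hy. exact Hy.
    - exists q. exact Hq. }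
  destruct (functional_choice _ Hex) as [phi Hphi].
  exists phi, l. split; [intros N; apply Hphi|].
  intros e He. destruct (archimed_cor1 e He) as [N [HN HN0]].
  exists N. intros k Hk.
  eapply Rlt_trans; [exact (proj2 (Hphi k))|]. eapply Rle_lt_trans; [|exact HN].
  apply Rinv_le_contravar; [apply lt_0_INR; lia|].
  apply le_INR in Hk. lra.
Qed.

Lemma bounded_subsequence_vec (n : nat) (x : nat -> rvec) (C : R) :
  (forall N i, (i < n)%nat -> Rabs (x N i) <= C) ->
  exists (phi : nat -> nat) (y : rvec), (forall N, (N <= phi N)%nat) /\
    forall i, (i < n)%nat -> Un_cv (fun N => x (phi N) i) (y i).
Proof.
  induction n as [|n IH]; intros H.
  - exists (fun N => N), (fun _ => 0). split; [lia | intros; lia].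
  - destruct IH as [phi [y [Hphi Hy]]]; [intros; apply H; lia|].
    destruct (bounded_subsequence (fun N => x (phi N) n) C) as [psi [l [Hpsi Hl]]].
    { intros N. apply H. lia. }
    exists (fun N => phi (psi N)), (fun i => if Nat.eq_dec i n then l else y i).
    split.
    + intros N. specialize (Hpsi N). specialize (Hphi (psi N)). lia.
    + intros i Hi. destruct (Nat.eq_dec i n) as [->|Hne]; [exact Hl|].
      apply (Un_cv_subseq (fun N => x (phi N) i)); [exact Hpsi | apply Hy; lia].
Qed.

Lemma Un_cv_nonneg (u : nat -> R) (l : R) (N0 : nat) :
  (forall N, (N0 <= N)%nat -> 0 <= u N) -> Un_cv u l -> 0 <= l.
Proof.
  intros H Hu. destruct (Rle_dec 0 l) as [h|h]; [exact h|].
  destruct (Hu (- l)) as [N HN]; [lra|].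
  specialize (HN (N + N0)%nat ltac:(lia)). specialize (H (N + N0)%nat ltac:(lia)).
  unfold Rdist in HN. rewrite Rabs_pos_eq in HN; lra.
Qed.

(** Both [e] and [e + u] are nondecreasing and bounded, hence converge, and [u] is their difference;
    the parameter [s] in the proof treats the two at once. *)
Lemma Un_cv_dominated_increments (u e : nat -> R) (B : R) :
  (forall m, Rabs (u (S m) - u m) <= e (S m) - e m) ->
  (forall m, Rabs (u m) <= B) -> (forall m, Rabs (e m) <= B) -> exists l, Un_cv u l.
Proof.
  intros H Hu He.
  assert (Hcv : forall s : R, 0 <= s <= 1 -> exists l, Un_cv (fun m => e m + s * u m) l).
  { intros s Hs. destruct (growing_cv (fun m => e m + s * u m)) as [l Hl]; [| |now exists l].
    - intros m. specialize (H m). revert H. unfold Rabs. destruct (Rcase_abs _); nra.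
    - exists (2 * B). intros x [m ->]. specialize (Hu m). specialize (He m).
      revert Hu He. unfold Rabs. destruct (Rcase_abs (u m)), (Rcase_abs (e m)); nra. }
  destruct (Hcv 1) as [l1 H1]; [lra|]. destruct (Hcv 0) as [l0 H0]; [lra|].
  exists (l1 - l0).
  apply (Un_cv_ext (fun m => (e m + 1 * u m) - (e m + 0 * u m))); [intros; ring|].
  now apply (CV_minus (fun m => e m + 1 * u m) (fun m => e m + 0 * u m)).
Qed.

Lemma Un_cv_near (u : nat -> R) (l a e : R) :
  (forall m, Rabs (u m - a) <= e) -> Un_cv u l -> Rabs (l - a) <= e.
Proof.
  intros H Hu. apply Rnot_lt_le. intros Hlt.
  destruct (Hu (Rabs (l - a) - e)) as [N HN]; [lra|].
  specialize (HN N ltac:(lia)). specialize (H N). unfold Rdist in HN.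
  assert (H1 := Rabs_triang (u N - a) (- (u N - l))). rewrite Rabs_Ropp in H1.
  replace (u N - a + - (u N - l)) with (l - a) in H1 by ring. lra.
Qed.

(** Serves to exclude further asymptotic directions. Vectors equal to [u] are exempt, just as the
    definition of an accumulation point ignores the point itself. *)
Lemma finite_gap (n J : nat) (w : nat -> rvec) (u : rvec) :
  exists g, 0 < g /\ forall j, (j < J)%nat -> ~ veq n (w j) u ->
    exists c, (c < n)%nat /\ g <= Rabs (w j c - u c).
Proof.
  induction J as [|J [g [Hg IH]]]; [exists 1; split; [lra | intros; lia]|].
  destruct (classic (veq n (w J) u)) as [h|h].
  - exists g. split; [exact Hg|]. intros j Hj Hne.
    destruct (Nat.eq_dec j J) as [->|]; [contradiction|]. apply IH; [lia | exact Hne].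
  - apply not_all_ex_not in h. destruct h as [c h]. apply imply_to_and in h. destruct h as [Hc h].
    assert (Hpos : 0 < Rabs (w J c - u c)) by (apply Rabs_pos_lt; lra).
    exists (Rmin g (Rabs (w J c - u c))). split; [now apply Rmin_glb_lt|].
    intros j Hj Hne. destruct (Nat.eq_dec j J) as [->|].
    + exists c. split; [exact Hc | apply Rmin_r].
    + destruct (IH j ltac:(lia) Hne) as [c' [Hc' H]]. exists c'. split; [exact Hc'|].
      eapply Rle_trans; [apply Rmin_l | exact H].
Qed.

(** * The lattice bases *)

(** The pair is (p_k, r_k). Rounding p_{k+1}^beta up to an integer keeps p_{k+2} comparable to
    p_{k+1}^(1+beta), and the factor [M] makes all later ratios large from the start. *)
Fixpoint growth_pair (M : Z) (beta : R) (k : nat) : Z * Z :=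
  match k with
  | O => (1, 1)%Z
  | S j => let '(p, r) := growth_pair M beta j in
           ((p * r)%Z, (M * up (Rpower (IZR (p * r)) beta))%Z)
  end.

Lemma growth_sequence (beta B : R) : 0 < beta ->
  exists (M : Z) (p r : nat -> Z) (C : R),
    B <= IZR M /\ p O = 1%Z /\ r O = 1%Z /\ (forall k, p (S k) = (p k * r k)%Z) /\
    (forall k, IZR M * 2 ^ k <= IZR (r (S k))) /\ 0 < C /\
    (forall k, Rpower (IZR (p k)) (1 + beta) <= IZR (p (S k)) <= C * Rpower (IZR (p k)) (1 + beta)).
Proof.
  intros Hb.
  (* Beyond the bound [B] demanded by the later estimates, M >= 2^(1/beta) makes p_{k+1}^beta at
     least double at each step, so that r_k grows geometrically however small beta is. *)
  set (M := up (Rmax 1 (Rmax B (Rpower 2 (/ beta))))).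
  assert (HM : 1 <= IZR M /\ B <= IZR M /\ Rpower 2 (/ beta) <= IZR M).
  { unfold M. destruct (archimed (Rmax 1 (Rmax B (Rpower 2 (/ beta))))) as [H _].
    assert (H1 := Rmax_l 1 (Rmax B (Rpower 2 (/ beta)))).
    assert (H2 := Rmax_r 1 (Rmax B (Rpower 2 (/ beta)))).
    assert (H3 := Rmax_l B (Rpower 2 (/ beta))).
    assert (H4 := Rmax_r B (Rpower 2 (/ beta))). lra. }
  destruct HM as [HM1 [HMB HM2]].
  set (p := fun k => fst (growth_pair M beta k)).
  set (r := fun k => snd (growth_pair M beta k)).
  assert (Hp : forall k, p (S k) = (p k * r k)%Z).
  { intros k. unfold p, r. simpl. destruct (growth_pair M beta k); reflexivity. }
  assert (Hr : forall k, r (S k) = (M * up (Rpower (IZR (p (S k))) beta))%Z).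
  { intros k. rewrite Hp. unfold p, r. simpl. destruct (growth_pair M beta k); reflexivity. }
  assert (Hup : forall x, 0 < x -> Rpower x beta <= IZR (up (Rpower x beta)) <= Rpower x beta + 1).
  { intros x Hx. destruct (archimed (Rpower x beta)). lra. }
  assert (HR1 : forall x, 1 <= x -> 1 <= Rpower x beta).
  { intros x Hx. rewrite <- (Rpower_1 1) by lra.
    replace (Rpower 1 1) with (Rpower 1 beta).
    - apply Rle_Rpower_l; lra.
    - unfold Rpower. rewrite ln_1. f_equal. ring. }
  assert (HM2' : 2 <= Rpower (IZR M) beta).
  { replace 2 with (Rpower (Rpower 2 (/ beta)) beta).
    - apply Rle_Rpower_l; [lra | split; [apply exp_pos | exact HM2]].
    - rewrite Rpower_mult, Rinv_l, Rpower_1; lra. }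
  assert (Hinv : forall k, 1 <= IZR (p (S k)) /\ 2 ^ k <= Rpower (IZR (p (S k))) beta).
  { induction k as [|k [IH1 IH2]].
    - assert (p 1%nat = 1%Z) as -> by reflexivity. split; [lra|]. simpl pow. apply HR1. lra.
    - rewrite Hp, Hr, mult_IZR, mult_IZR.
      destruct (Hup (IZR (p (S k)))) as [H1 _]; [lra|].
      assert (H2 := HR1 _ IH1).
      set (u := IZR (up (Rpower (IZR (p (S k))) beta))) in *.
      set (q := IZR (p (S k))) in *.
      assert (H3 : q * IZR M <= q * (IZR M * u)).
      { apply Rmult_le_compat_l; [lra|]. nra. }
      split; [nra|].
      apply Rle_trans with (Rpower (q * IZR M) beta).
      + rewrite <- Rpower_mult_distr by lra. simpl.
        assert (0 < 2 ^ k) by (apply pow_lt; lra). nra.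
      + apply Rle_Rpower_l; [lra | split; [nra | exact H3]]. }
  assert (Hsplit : forall x, 0 < x -> Rpower x (1 + beta) = x * Rpower x beta).
  { intros x Hx. rewrite Rpower_plus, Rpower_1; lra. }
  (* The factor 2 absorbs the rounding: [up x <= x + 1 <= 2 x] for x = p_{k+1}^beta >= 1. *)
  exists M, p, r, (2 * IZR M).
  repeat split; try assumption; try reflexivity; try lra.
  - intros k. rewrite Hr, mult_IZR. destruct (Hinv k) as [H1 H2].
    destruct (Hup (IZR (p (S k)))) as [H3 _]; [lra|].
    apply Rmult_le_compat_l; lra.
  - destruct k as [|k].
    + assert (p O = 1%Z) as -> by reflexivity. assert (p 1%nat = 1%Z) as -> by reflexivity.
      unfold Rpower. rewrite ln_1, Rmult_0_r, exp_0. lra.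
    + destruct (Hinv k) as [H1 H2].
      destruct (Hup (IZR (p (S k)))) as [H3 _]; [lra|].
      rewrite (Hp (S k)), Hr, mult_IZR, mult_IZR, Hsplit by lra.
      assert (H4 := HR1 _ H1).
      apply Rmult_le_compat_l; [lra|]. nra.
  - destruct k as [|k].
    + assert (p O = 1%Z) as -> by reflexivity. assert (p 1%nat = 1%Z) as -> by reflexivity.
      unfold Rpower. rewrite ln_1, Rmult_0_r, exp_0. lra.
    + destruct (Hinv k) as [H1 H2].
      destruct (Hup (IZR (p (S k)))) as [_ H3]; [lra|].
      rewrite (Hp (S k)), Hr, mult_IZR, mult_IZR, Hsplit by lra.
      assert (H4 := HR1 _ H1).
      replace (2 * IZR M * (IZR (p (S k)) * Rpower (IZR (p (S k))) beta))
        with (IZR (p (S k)) * (2 * IZR M * Rpower (IZR (p (S k))) beta)) by ring.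
      apply Rmult_le_compat_l; [lra|]. nra.
Qed.

Section Basis.
Variables (n : nat) (K M : Z) (p r : nat -> Z).

(* In the notation of the header: index [0] is v_k, index [i] with [1 <= i <= n] is w_i, index [n+1] is
   v_{k+1} and index [n+2] is v_{k+2}; [c] is the coordinate.  Initially v_0 is the last unit vector, along
   which the form takes the value 1. *)
Fixpoint basis (k i c : nat) : Z :=
  match k with
  | O => match i with
         | O => if (c =? S (S n))%nat then 1%Z else 0%Z
         | S j => if (c =? j)%nat then 1%Z else 0%Z
         end
  | S k' =>
      match i with
      | O => basis k' (S n) c
      | S j =>
          if (j =? n)%nat then basis k' (S (S n)) c
          else if (j =? S n)%nat
          then (r k' * r (S k') * basis k' (S n) c + K * basis k' (S (S n)) c + basis k' n c)%Z
          else (r (S k') * basis k' (S j) c - basis k' j c)%Z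
      end
  end.

Lemma basis_S_0 k c : basis (S k) O c = basis k (S n) c.
Proof. reflexivity. Qed.

Lemma basis_S_mid k j c : (j < n)%nat ->
  basis (S k) (S j) c = (r (S k) * basis k (S j) c - basis k j c)%Z.
Proof.
  intros Hj. simpl.
  destruct (Nat.eqb_spec j n); [lia|]. destruct (Nat.eqb_spec j (S n)); [lia|]. reflexivity.
Qed.

Lemma basis_S_n1 k c : basis (S k) (S n) c = basis k (S (S n)) c.
Proof. simpl. now rewrite Nat.eqb_refl. Qed.

Lemma basis_S_n2 k c : basis (S k) (S (S n)) c =
  (r k * r (S k) * basis k (S n) c + K * basis k (S (S n)) c + basis k n c)%Z.
Proof.
  cbn [basis]. destruct (Nat.eqb_spec (S n) n); [lia|]. now rewrite Nat.eqb_refl.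
Qed.

(** Unimodularity in the form that the estimates call for: integer coefficients in the basis. The
    equation is stated over the reals so that [rsum] can express it. *)
Definition spanned (k : nat) (z : zvec) : Prop :=
  exists m : nat -> Z, forall c, (c < S (S (S n)))%nat ->
    IZR (z c) = rsum (S (S (S n))) (fun i => IZR (m i) * IZR (basis k i c)).

Lemma spanned_basis k i : (i < S (S (S n)))%nat -> spanned k (basis k i).
Proof.
  intros Hi. exists (fun j => if (j =? i)%nat then 1%Z else 0%Z). intros c Hc.
  rewrite (rsum_single _ _ i Hi).
  - rewrite Nat.eqb_refl. ring.
  - intros j _ Hne. destruct (Nat.eqb_spec j i); [lia | ring].
Qed.

Lemma spanned_lin k (a b : Z) (x y z : zvec) : spanned k x -> spanned k y ->
  (forall c, (c < S (S (S n)))%nat -> z c = (a * x c + b * y c)%Z) -> spanned k z.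
Proof.
  intros [m Hm] [m' Hm'] Hz. exists (fun i => (a * m i + b * m' i)%Z). intros c Hc.
  rewrite Hz, plus_IZR, mult_IZR, mult_IZR, Hm, Hm', <- !rsum_scal, <- rsum_plus by assumption.
  apply rsum_ext. intros i _. rewrite plus_IZR, !mult_IZR. ring.
Qed.

Lemma spanned_sum k (N : nat) (m : nat -> Z) (X : nat -> zvec) (z : zvec) :
  (forall i, (i < N)%nat -> spanned k (X i)) ->
  (forall c, (c < S (S (S n)))%nat -> IZR (z c) = rsum N (fun i => IZR (m i) * IZR (X i c))) ->
  spanned k z.
Proof.
  revert z. induction N as [|N IH]; intros z HX Hz.
  - exists (fun _ => 0%Z). intros c Hc. rewrite Hz by assumption. simpl rsum at 1.
    symmetry. apply rsum_zero. intros. ring.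
  - apply (spanned_lin k 1 (m N) (fun c => z c - m N * X N c)%Z (X N)).
    + apply IH; [intros; apply HX; lia|].
      intros c Hc. rewrite minus_IZR, mult_IZR, Hz by assumption. simpl. ring.
    + apply HX. lia.
    + intros c _. ring.
Qed.

(** The recursion is inverted: v_{k+1} and v_{k+2} persist, [basis k n] is recovered from v_{k+3},
    and then w_{i-1} = r_{k+1} w_i - w_i' descends through the remaining indices. *)
Lemma spanned_step k i : (i < S (S (S n)))%nat -> spanned (S k) (basis k i).
Proof.
  assert (H1 : spanned (S k) (basis k (S n))).
  { apply (spanned_lin _ 1 0 (basis (S k) 0) (basis (S k) 0));
      try (apply spanned_basis; lia). intros; rewrite basis_S_0; ring. }
  assert (H2 : spanned (S k) (basis k (S (S n)))).
  { apply (spanned_lin _ 1 0 (basis (S k) (S n)) (basis (S k) (S n)));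
      try (apply spanned_basis; lia). intros; rewrite basis_S_n1; ring. }
  assert (H3 : forall j, (j <= n)%nat -> spanned (S k) (basis k (n - j))).
  { induction j as [|j IH]; intros Hj.
    - rewrite Nat.sub_0_r.
      apply (spanned_lin _ 1 (- (r k * r (S k))) (fun c => basis (S k) (S (S n)) c - K * basis k (S (S n)) c)%Z
               (basis k (S n))); [|assumption|].
      + apply (spanned_lin _ 1 (- K) (basis (S k) (S (S n))) (basis k (S (S n))));
          [apply spanned_basis; lia | assumption | intros; ring].
      + intros c _. rewrite basis_S_n2. ring.
    - apply (spanned_lin _ (r (S k)) (- 1) (basis k (n - j)) (basis (S k) (n - j)));
        [apply IH; lia | apply spanned_basis; lia |].
      intros c _. replace (n - j)%nat with (S (n - S j)) by lia.
      rewrite basis_S_mid by lia. ring. }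
  intros Hi.
  destruct (Nat.eq_dec i (S n)) as [->|]; [assumption|].
  destruct (Nat.eq_dec i (S (S n))) as [->|]; [assumption|].
  replace i with (n - (n - i))%nat by lia. apply H3. lia.
Qed.

Lemma spanned_all k (z : zvec) : spanned k z.
Proof.
  induction k as [|k IH].
  - exists (fun i => match i with O => z (S (S n)) | S j => z j end). intros c Hc.
    destruct (Nat.eq_dec c (S (S n))) as [->|Hne].
    + rewrite (rsum_single (S (S (S n))) _ O ltac:(lia)).
      * simpl. rewrite Nat.eqb_refl. ring.
      * intros i Hi Hi0. destruct i as [|i]; [lia|].
        change (basis 0 (S i) (S (S n))) with (if (S (S n) =? i)%nat then 1%Z else 0%Z).
        destruct (Nat.eqb_spec (S (S n)) i); [lia | ring].
    + rewrite (rsum_single (S (S (S n))) _ (S c) ltac:(lia)).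
      * simpl. rewrite Nat.eqb_refl. ring.
      * intros i Hi Hi0. destruct i as [|i].
        -- change (basis 0 0 c) with (if (c =? S (S n))%nat then 1%Z else 0%Z).
           destruct (Nat.eqb_spec c (S (S n))); [lia | ring].
        -- change (basis 0 (S i) c) with (if (c =? i)%nat then 1%Z else 0%Z).
           destruct (Nat.eqb_spec c i); [lia | ring].
  - destruct IH as [m Hm].
    apply (spanned_sum (S k) (S (S (S n))) m (basis k) z); [intros; now apply spanned_step | exact Hm].
Qed.

(** * Sizes and directions of the basis vectors *)

Hypothesis p_0 : p O = 1%Z.
Hypothesis r_0 : r O = 1%Z.
Hypothesis p_S : forall k, p (S k) = (p k * r k)%Z.
Hypothesis r_S : forall k, IZR M * 2 ^ k <= IZR (r (S k)).
Let d : R := INR (S (S (S n))).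
Hypothesis K_eq : IZR K = 16 * d.
Hypothesis M_ge : 1000 * d ^ 2 <= IZR M.

Lemma d_ge_3 : 3 <= d.
Proof. unfold d. rewrite !S_INR. assert (H := pos_INR n). lra. Qed.

Lemma M_ge_d : 3000 * d <= IZR M.
Proof. assert (H := d_ge_3). nra. Qed.

Lemma pow2_ge_1 k : 1 <= 2 ^ k.
Proof. apply pow_R1_Rle. lra. Qed.

Lemma r_S_ge_M k : IZR M <= IZR (r (S k)).
Proof.
  assert (H := r_S k). assert (H1 := pow2_ge_1 k). assert (H2 := M_ge_d). assert (H3 := d_ge_3). nra.
Qed.

Lemma r_ge_1 k : 1 <= IZR (r k).
Proof.
  destruct k; [rewrite r_0; lra|].
  assert (H := r_S_ge_M k). assert (H2 := M_ge_d). assert (H3 := d_ge_3). lra.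
Qed.

Lemma p_S_R k : IZR (p (S k)) = IZR (p k) * IZR (r k).
Proof. now rewrite p_S, mult_IZR. Qed.

Lemma p_ge_1 k : 1 <= IZR (p k).
Proof.
  induction k as [|k IH]; [rewrite p_0; lra|].
  rewrite p_S_R. assert (H := r_ge_1 k). nra.
Qed.

Lemma p_le_S k : IZR (p k) <= IZR (p (S k)).
Proof. rewrite p_S_R. assert (H := r_ge_1 k). assert (H1 := p_ge_1 k). nra. Qed.

Lemma p_SS_ge k : IZR M * IZR (p (S k)) <= IZR (p (S (S k))).
Proof. rewrite (p_S_R (S k)). assert (H := r_S_ge_M k). assert (H1 := p_ge_1 (S k)). nra. Qed.

(* [size], [target] and [defect] say that [basis k (S i)] is [size k i] times a unit vector, up to a
   relative error [defect k].  The vectors v_k of either parity keep their own target coordinate, so indices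
   [n] and [S n] are exchanged at each step. *)
Definition size (k i : nat) : R := if (i =? n)%nat then IZR (p k) else IZR (p (S k)).

Definition target (k i : nat) : nat :=
  if Nat.even k then i
  else if (i =? n)%nat then S n else if (i =? S n)%nat then n else i.

Definition defect (k : nat) : R := (2 * IZR K + 2) / IZR M * (2 - 2 * (1 / 2) ^ k).

Definition unit_at (a c : nat) : R := if (c =? a)%nat then 1 else 0.

Lemma size_n k : size k n = IZR (p k).
Proof. unfold size. now rewrite Nat.eqb_refl. Qed.

Lemma size_ne k i : i <> n -> size k i = IZR (p (S k)).
Proof. intros H. unfold size. destruct (Nat.eqb_spec i n); [lia | reflexivity]. Qed.

Lemma size_pos k i : 1 <= size k i.
Proof. unfold size. destruct (i =? n)%nat; apply p_ge_1. Qed.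

Lemma size_le k i : size k i <= IZR (p (S k)).
Proof. unfold size. destruct (i =? n)%nat; [apply p_le_S | lra]. Qed.

Lemma target_lt k i : (i < S (S n))%nat -> (target k i < S (S n))%nat.
Proof.
  unfold target. destruct (Nat.even k); [lia|].
  destruct (Nat.eqb_spec i n); [lia|]. destruct (Nat.eqb_spec i (S n)); lia.
Qed.

Lemma target_inj k i j : target k i = target k j -> i = j.
Proof.
  unfold target. destruct (Nat.even k); [lia|].
  destruct (Nat.eqb_spec i n), (Nat.eqb_spec j n), (Nat.eqb_spec i (S n)), (Nat.eqb_spec j (S n)); simpl; intros; lia.
Qed.

Lemma target_mid k i : (i < n)%nat -> target k i = i.
Proof.
  intros Hi. unfold target. destruct (Nat.even k); [lia|].
  destruct (Nat.eqb_spec i n); [lia|]. destruct (Nat.eqb_spec i (S n)); lia.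
Qed.

Lemma target_S_n k : target (S k) n = target k (S n).
Proof.
  unfold target. rewrite Nat.even_succ, <- Nat.negb_even.
  destruct (Nat.even k); cbn [negb];
  destruct (Nat.eqb_spec n n), (Nat.eqb_spec n (S n)), (Nat.eqb_spec (S n) n), (Nat.eqb_spec (S n) (S n)); cbv iota; lia.
Qed.

Lemma target_S_Sn k : target (S k) (S n) = target k n.
Proof.
  unfold target. rewrite Nat.even_succ, <- Nat.negb_even.
  destruct (Nat.even k); cbn [negb];
  destruct (Nat.eqb_spec n n), (Nat.eqb_spec n (S n)), (Nat.eqb_spec (S n) n), (Nat.eqb_spec (S n) (S n)); cbv iota; lia.
Qed.

(** [defect k] is thus the closed form of the sum of the relative errors (2K + 2) / (M 2^j)
    committed at the steps j < k. *)
Lemma defect_S k : defect (S k) = defect k + (2 * IZR K + 2) / (IZR M * 2 ^ k).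
Proof.
  unfold defect. assert (H2 := M_ge_d). assert (H3 := d_ge_3).
  assert (Hp : 2 ^ k <> 0) by (apply pow_nonzero; lra).
  rewrite <- tech_pow_Rmult. unfold Rdiv. rewrite Rmult_1_l, pow_inv. field. split; [exact Hp | lra].
Qed.

Lemma defect_increment k : (2 * IZR K + 2) / IZR (r (S k)) <= defect (S k) - defect k.
Proof.
  rewrite defect_S. assert (H := r_S k). assert (H1 := pow2_ge_1 k).
  assert (H2 := M_ge_d). assert (H3 := d_ge_3).
  assert ((2 * IZR K + 2) / IZR (r (S k)) <= (2 * IZR K + 2) / (IZR M * 2 ^ k)); [|lra].
  unfold Rdiv. apply Rmult_le_compat_l; [rewrite K_eq; lra|].
  apply Rinv_le_contravar; [nra | exact H].
Qed.

Lemma defect_le_S k : defect k <= defect (S k).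
Proof.
  assert (H := defect_increment k).
  assert (0 <= (2 * IZR K + 2) / IZR (r (S k))); [|lra].
  apply Rle_mult_inv_pos; [rewrite K_eq; assert (H3 := d_ge_3); lra | assert (H1 := r_ge_1 (S k)); lra].
Qed.

Lemma defect_nonneg k : 0 <= defect k.
Proof.
  induction k as [|k IH]; [unfold defect; simpl; lra|].
  assert (H := defect_le_S k). lra.
Qed.

(** The full sum is 2 (2K + 2) / M, and with K = 16 d one has 2 (2K + 2) 8d = 512 d^2 + 32 d <= 1000
    d^2 <= M. The target 1/(8d) is what [coefficient_bound] can absorb. *)
Lemma defect_le k : defect k <= / (8 * d).
Proof.
  assert (H2 := M_ge_d). assert (H3 := d_ge_3).
  unfold defect.
  assert (Hh : 0 < (1 / 2) ^ k) by (apply pow_lt; lra).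
  apply Rle_trans with ((2 * IZR K + 2) / IZR M * 2).
  { apply Rmult_le_compat_l; [|lra].
    apply Rle_mult_inv_pos; [rewrite K_eq; lra | lra]. }
  rewrite K_eq. apply (Rmult_le_reg_r (IZR M * (8 * d))); [nra|].
  replace ((2 * (16 * d) + 2) / IZR M * 2 * (IZR M * (8 * d))) with ((2 * (16 * d) + 2) * 2 * (8 * d)) by (field; lra).
  replace (/ (8 * d) * (IZR M * (8 * d))) with (IZR M) by (field; lra).
  nra.
Qed.

Lemma defect_le_1 k : defect k <= 1 / 24.
Proof.
  assert (H := defect_le k). assert (H3 := d_ge_3).
  assert (/ (8 * d) <= / 24) by (apply Rinv_le_contravar; lra). lra.
Qed.

Lemma near_abs_le (x s u e : R) : 0 <= s -> e <= 1 / 24 -> 0 <= u <= 1 ->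
  Rabs (x - s * u) <= e * s -> Rabs x <= 2 * s.
Proof.
  intros Hs He Hu H.
  replace x with ((x - s * u) + s * u) by ring.
  eapply Rle_trans; [apply Rabs_triang|].
  rewrite (Rabs_pos_eq (s * u)) by nra. nra.
Qed.

Lemma unit_at_bounds a c : 0 <= unit_at a c <= 1.
Proof. unfold unit_at. destruct (c =? a)%nat; lra. Qed.

(** Every new vector is a large multiple of an old one with the same target coordinate, plus lower
    terms. Index 0 gets only an upper bound, because there are d vectors but d - 1 targets. The last
    coordinate is never a target, so there the estimate says that the entry is relatively small. *)
Lemma basis_near k :
  (forall c, (c < S (S (S n)))%nat -> Rabs (IZR (basis k O c)) <= 2 * IZR (p k)) /\
  (forall i c, (i < S (S n))%nat -> (c < S (S (S n)))%nat ->
    Rabs (IZR (basis k (S i) c) - size k i * unit_at (target k i) c) <= defect k * size k i).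
Proof.
  induction k as [|k [IH0 IH]].
  - split.
    + intros c Hc. simpl. rewrite p_0. destruct (c =? S (S n))%nat; rewrite Rabs_pos_eq; lra.
    + intros i c Hi Hc.
      assert (size O i = 1) as ->.
      { unfold size. rewrite p_S, p_0, r_0. destruct (i =? n)%nat; reflexivity. }
      change (basis 0 (S i) c) with (if (c =? i)%nat then 1%Z else 0%Z).
      change (target 0 i) with i. unfold unit_at.
      assert (H := defect_nonneg O).
      destruct (c =? i)%nat; rewrite Rabs_right; lra.
  - assert (Hb : forall i c, (i < S (S (S n)))%nat -> (c < S (S (S n)))%nat ->
                  Rabs (IZR (basis k i c)) <= 2 * IZR (p (S k))).
    { intros [|i] c Hi Hc.
      - assert (H := IH0 c Hc). assert (H1 := p_le_S k). lra.
      - assert (H := IH i c ltac:(lia) Hc). assert (H1 := size_pos k i). assert (H2 := size_le k i).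
        eapply Rle_trans; [eapply near_abs_le; [| | |exact H]|];
          [lra | apply defect_le_1 | apply unit_at_bounds | lra]. }
    assert (HrS := r_ge_1 (S k)). assert (Hrk := r_ge_1 k).
    assert (HpS := p_ge_1 (S k)). assert (Hpk := p_ge_1 k).
    assert (Hinc := defect_increment k).
    (* The lower terms are at most (2K + 2) p_{k+1}, since old entries are at most 2 p_{k+1};
       relative to p_{k+2} = p_{k+1} r_{k+1} this is within one increment of [defect]. *)
    assert (Hinc' : (2 * IZR K + 2) * IZR (p (S k)) <= (defect (S k) - defect k) * IZR (p (S (S k)))).
    { rewrite (p_S_R (S k)).
      replace ((2 * IZR K + 2) * IZR (p (S k))) with
        ((2 * IZR K + 2) / IZR (r (S k)) * (IZR (p (S k)) * IZR (r (S k)))) by (field; lra).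
      apply Rmult_le_compat_r; [nra | exact Hinc]. }
    assert (HK : 0 <= IZR K) by (rewrite K_eq; assert (H3 := d_ge_3); lra).
    split.
    + intros c Hc. rewrite basis_S_0.
      assert (H := IH n c ltac:(lia) Hc). rewrite size_n in H.
      eapply Rle_trans; [eapply near_abs_le; [| | |exact H]|];
        [lra | apply defect_le_1 | apply unit_at_bounds |].
      assert (H1 := p_le_S k). lra.
    + intros i c Hi Hc.
      destruct (Nat.eq_dec i n) as [->|Hin].
      * rewrite basis_S_n1, size_n, target_S_n.
        assert (H := IH (S n) c ltac:(lia) Hc). rewrite size_ne in H by lia.
        assert (H1 := defect_le_S k). nra.
      * rewrite (size_ne (S k) i Hin).
        destruct (Nat.eq_dec i (S n)) as [->|Hin'].
        -- rewrite basis_S_n2, target_S_Sn, !plus_IZR, !mult_IZR.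
           assert (H := IH n c ltac:(lia) Hc). rewrite size_n in H.
           assert (H1 := Hb (S (S n)) c ltac:(lia) Hc).
           assert (H2 := Hb n c ltac:(lia) Hc).
           set (x := IZR (basis k (S n) c)) in *.
           set (y := IZR (basis k (S (S n)) c)) in *.
           set (w := IZR (basis k n c)) in *.
           set (u := unit_at (target k n) c) in *.
           set (e := defect k) in *. set (e' := defect (S k)) in *.
           assert (Hp2 : IZR (p (S (S k))) = IZR (r k) * IZR (r (S k)) * IZR (p k)) by (rewrite !p_S_R; ring).
           replace (IZR (r k) * IZR (r (S k)) * x + IZR K * y + w - IZR (p (S (S k))) * u)
             with (IZR (r k) * IZR (r (S k)) * (x - IZR (p k) * u) + (IZR K * y + w)) by (rewrite Hp2; ring).
           eapply Rle_trans; [apply Rabs_triang|].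
           rewrite Rabs_mult, (Rabs_pos_eq (IZR (r k) * IZR (r (S k)))) by nra.
           assert (H3 : Rabs (IZR K * y + w) <= (2 * IZR K + 2) * IZR (p (S k))).
           { eapply Rle_trans; [apply Rabs_triang|].
             rewrite Rabs_mult, (Rabs_pos_eq (IZR K)) by exact HK. nra. }
           assert (H4 : IZR (r k) * IZR (r (S k)) * Rabs (x - IZR (p k) * u) <= e * IZR (p (S (S k)))).
           { rewrite Hp2. replace (e * (IZR (r k) * IZR (r (S k)) * IZR (p k))) with
               (IZR (r k) * IZR (r (S k)) * (e * IZR (p k))) by ring.
             apply Rmult_le_compat_l; [nra | exact H]. }
           lra.
        -- rewrite basis_S_mid, minus_IZR, mult_IZR by lia.
           rewrite (target_mid (S k)) by lia.
           assert (H := IH i c ltac:(lia) Hc). rewrite size_ne, target_mid in H by lia.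
           assert (H2 := Hb i c ltac:(lia) Hc).
           set (x := IZR (basis k (S i) c)) in *.
           set (w := IZR (basis k i c)) in *.
           set (u := unit_at i c) in *.
           set (e := defect k) in *. set (e' := defect (S k)) in *.
           rewrite (p_S_R (S k)) in *.
           replace (IZR (r (S k)) * x - w - IZR (p (S k)) * IZR (r (S k)) * u)
             with (IZR (r (S k)) * (x - IZR (p (S k)) * u) + - w) by ring.
           eapply Rle_trans; [apply Rabs_triang|].
           rewrite Rabs_mult, Rabs_Ropp, (Rabs_pos_eq (IZR (r (S k)))) by lra.
           assert (H4 : IZR (r (S k)) * Rabs (x - IZR (p (S k)) * u) <= e * (IZR (p (S k)) * IZR (r (S k)))).
           { replace (e * (IZR (p (S k)) * IZR (r (S k)))) with (IZR (r (S k)) * (e * IZR (p (S k)))) by ring.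
             apply Rmult_le_compat_l; [lra | exact H]. }
           nra.
Qed.

Lemma basis_abs_le k i c : (i < S (S (S n)))%nat -> (c < S (S (S n)))%nat ->
  Rabs (IZR (basis k i c)) <= 2 * IZR (p (S k)).
Proof.
  destruct (basis_near k) as [H0 H1]. intros Hi Hc. destruct i as [|i].
  - assert (H := H0 c Hc). assert (H2 := p_le_S k). lra.
  - assert (H := H1 i c ltac:(lia) Hc). assert (H2 := size_pos k i). assert (H3 := size_le k i).
    eapply Rle_trans; [eapply near_abs_le; [| | |exact H]|];
      [lra | apply defect_le_1 | apply unit_at_bounds | lra].
Qed.

(** Coordinate [target k i] of z reads off the coefficient of [basis k (S i)] up to an error
    [defect k * N], where N is the sum to be bounded. Summing over i gives N <= d (Y + defect N),
    and d defect <= 1/8 lets N be absorbed. The multiple of v_k is subtracted from z because v_k has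
    no target. *)
Lemma coefficient_bound k (m : nat -> Z) (z : zvec) (Y : R) :
  0 <= Y ->
  (forall c, (c < S (S (S n)))%nat ->
    IZR (z c) = rsum (S (S (S n))) (fun i => IZR (m i) * IZR (basis k i c))) ->
  (forall c, (c < S (S n))%nat -> Rabs (IZR (z c) - IZR (m O) * IZR (basis k O c)) <= Y) ->
  rsum (S (S n)) (fun i => Rabs (IZR (m (S i))) * size k i) <= 2 * d * Y.
Proof.
  intros HY Hz Hy. destruct (basis_near k) as [_ Hnear].
  set (N := rsum (S (S n)) (fun i => Rabs (IZR (m (S i))) * size k i)).
  assert (He := defect_le k). assert (He0 := defect_nonneg k). assert (Hd := d_ge_3).
  assert (HN0 : 0 <= N).
  { apply rsum_nonneg. intros i _. assert (H := Rabs_pos (IZR (m (S i)))).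
    assert (H1 := size_pos k i). nra. }
  assert (Hi : forall i, (i < S (S n))%nat -> Rabs (IZR (m (S i))) * size k i <= Y + defect k * N).
  { intros i Hi.
    assert (Ht := target_lt k i Hi).
    assert (Hs := size_pos k i).
    rewrite <- (Rabs_pos_eq (size k i)) at 1 by lra. rewrite <- Rabs_mult.
    set (c := target k i) in *.
    replace (IZR (m (S i)) * size k i) with
      ((IZR (z c) - IZR (m O) * IZR (basis k O c)) +
       - rsum (S (S n)) (fun j => IZR (m (S j)) * (IZR (basis k (S j) c) - size k j * unit_at (target k j) c))).
    2: { rewrite Hz, rsum_succ_l by lia.
         rewrite (rsum_ext _ (fun j => IZR (m (S j)) * (IZR (basis k (S j) c) - size k j * unit_at (target k j) c))
           (fun j => IZR (m (S j)) * IZR (basis k (S j) c) +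
                     - 1 * (IZR (m (S j)) * size k j * unit_at (target k j) c))) by (intros; ring).
         rewrite rsum_plus, rsum_scal.
         rewrite (rsum_single _ (fun j => IZR (m (S j)) * size k j * unit_at (target k j) c) i Hi).
         - unfold unit_at, c. rewrite Nat.eqb_refl. ring.
         - intros j _ Hne. unfold unit_at, c. destruct (Nat.eqb_spec (target k i) (target k j)) as [e|_].
           + apply target_inj in e. lia.
           + ring. }
    eapply Rle_trans; [apply Rabs_triang|]. rewrite Rabs_Ropp.
    apply Rplus_le_compat; [apply Hy; lia|].
    eapply Rle_trans; [apply rsum_Rabs|]. unfold N. rewrite <- rsum_scal.
    apply rsum_le. intros j Hj. rewrite Rabs_mult.
    specialize (Hnear j c Hj ltac:(lia)). assert (H := Rabs_pos (IZR (m (S j)))). nra. }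
  assert (HN : N <= d * (Y + defect k * N)).
  { apply Rle_trans with (INR (S (S n)) * (Y + defect k * N)); [now apply rsum_le_const|].
    unfold d. rewrite (S_INR (S (S n))). nra. }
  assert (d * defect k <= 1 / 8).
  { apply Rle_trans with (d * / (8 * d)); [apply Rmult_le_compat_l; lra|]. right. field. lra. }
  nra.
Qed.

(** * Linear forms small on the bases *)

Section Functional.
Variable alpha : rvec.

Definition L (z : zvec) : R := Lform (S (S (S n))) alpha z.

(* The value of the form with the sign that it is going to have, so that [cone] asks for [lam >= 0]. *)
Definition lam (k i : nat) : R := (-1) ^ k * (if (i =? S n)%nat then -1 else 1) * L (basis k i).

Lemma L_ext (x y : zvec) : (forall c, (c < S (S (S n)))%nat -> x c = y c) -> L x = L y.
Proof. intros H. apply rsum_ext. intros c Hc. now rewrite H. Qed.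

Lemma L_lin (a b e : R) (x y w z : zvec) :
  (forall c, (c < S (S (S n)))%nat -> IZR (z c) = a * IZR (x c) + b * IZR (y c) + e * IZR (w c)) ->
  L z = a * L x + b * L y + e * L w.
Proof.
  intros H. unfold L, Lform. rewrite <- !rsum_scal, <- !rsum_plus.
  apply rsum_ext. intros c Hc. rewrite H by exact Hc. ring.
Qed.

Lemma L_comb (m : nat -> Z) (N : nat) (X : nat -> zvec) (z : zvec) :
  (forall c, (c < S (S (S n)))%nat -> IZR (z c) = rsum N (fun i => IZR (m i) * IZR (X i c))) ->
  L z = rsum N (fun i => IZR (m i) * L (X i)).
Proof.
  intros H. unfold L, Lform.
  rewrite (rsum_ext N _ (fun i => rsum (S (S (S n))) (fun c => IZR (m i) * (alpha c * IZR (X i c)))))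
    by (intros; now rewrite rsum_scal).
  rewrite rsum_swap. apply rsum_ext. intros c Hc. rewrite H by exact Hc.
  rewrite <- rsum_scal. apply rsum_ext. intros. ring.
Qed.

Lemma lam_0_0 : lam O O = alpha (S (S n)).
Proof.
  unfold lam. change (0 =? S n)%nat with false. cbv iota.
  assert (L (basis 0 0) = alpha (S (S n))) as ->; [|simpl; ring].
  unfold L, Lform. rewrite (rsum_single (S (S (S n))) _ (S (S n)) ltac:(lia)).
  - cbn [basis]. rewrite Nat.eqb_refl. ring.
  - intros c _ Hne. cbn [basis]. destruct (Nat.eqb_spec c (S (S n))); [lia | ring].
Qed.

Lemma lam_n1 k : lam k (S n) = lam (S k) O.
Proof.
  unfold lam. rewrite Nat.eqb_refl. change (0 =? S n)%nat with false.
  change (basis (S k) O) with (basis k (S n)). cbv iota. simpl pow. ring.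
Qed.

Lemma lam_n2 k : lam k (S (S n)) = lam (S k) (S n).
Proof.
  unfold lam. rewrite Nat.eqb_refl. destruct (Nat.eqb_spec (S (S n)) (S n)); [lia|].
  rewrite (L_ext (basis (S k) (S n)) (basis k (S (S n)))) by (intros; apply basis_S_n1). simpl pow. ring.
Qed.

Lemma lam_n k : lam k n =
  IZR (r k) * IZR (r (S k)) * lam k (S n) - IZR K * lam k (S (S n)) - lam (S k) (S (S n)).
Proof.
  unfold lam. rewrite Nat.eqb_refl. destruct (Nat.eqb_spec (S (S n)) (S n)); [lia|].
  destruct (Nat.eqb_spec n (S n)); [lia|].
  rewrite (L_lin (IZR (r k) * IZR (r (S k))) (IZR K) 1 (basis k (S n)) (basis k (S (S n))) (basis k n)
    (basis (S k) (S (S n)))).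
  - simpl pow. ring.
  - intros c _. rewrite basis_S_n2, !plus_IZR, !mult_IZR. ring.
Qed.

(** The sign (-1)^k flips between the levels, so the minus sign in w_i' = r_{k+1} w_i - w_{i-1}
    becomes a plus here; nonnegativity at level k + 1 therefore passes down to level k. *)
Lemma lam_mid k j : (j < n)%nat -> lam k j = IZR (r (S k)) * lam k (S j) + lam (S k) (S j).
Proof.
  intros Hj. unfold lam. destruct (Nat.eqb_spec j (S n)); [lia|]. destruct (Nat.eqb_spec (S j) (S n)); [lia|].
  rewrite (L_lin (IZR (r (S k))) (-1) 0 (basis k (S j)) (basis k j) (basis k j) (basis (S k) (S j))).
  - simpl pow. ring.
  - intros c _. rewrite basis_S_mid by lia. rewrite minus_IZR, mult_IZR. ring.
Qed.

Lemma Rabs_L_basis k i : Rabs (L (basis k i)) = Rabs (lam k i).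
Proof.
  unfold lam. rewrite !Rabs_mult, pow_1_abs.
  destruct (i =? S n)%nat; [rewrite (Rabs_left (-1)) by lra | rewrite Rabs_R1]; ring.
Qed.

(** Weak inequalities keep the set closed. At level 0 the basis is the standard one, so the upper
    bounds confine all coordinates of [alpha] to [-1, 1] once the last one is 1. *)
Definition cone (k : nat) : Prop := forall i, (i < S (S (S n)))%nat -> 0 <= lam k i <= lam k O.

Section Step.
Variable k : nat.
Hypothesis Hcone : cone (S k).

Lemma ratio_ge : IZR (r (S k)) <= IZR (r k) * IZR (r (S k)).
Proof. assert (H := r_ge_1 k). assert (H1 := r_ge_1 (S k)). nra. Qed.

Lemma K_bounds : 48 <= IZR K /\ 64 * (IZR K + 1) <= IZR (r (S k)) /\ 3000 * d <= IZR (r (S k)).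
Proof.
  assert (H := r_S_ge_M k). assert (H1 := M_ge_d). assert (H2 := d_ge_3). rewrite K_eq.
  repeat split; nra.
Qed.

(** The two subtracted values in [lam_n] are values at level k + 1, hence at most [lam (S k) 0],
    which is [lam k (S n)]. *)
Lemma lam_n_bounds :
  (IZR (r k) * IZR (r (S k)) - (IZR K + 1)) * lam k (S n) <= lam k n <=
  IZR (r k) * IZR (r (S k)) * lam k (S n).
Proof.
  destruct K_bounds as [H1 _].
  rewrite lam_n, lam_n2, lam_n1.
  destruct (Hcone (S n) ltac:(lia)), (Hcone (S (S n)) ltac:(lia)). nra.
Qed.

Lemma lam_n1_le_n : lam k (S n) <= lam k n.
Proof.
  destruct K_bounds as [H1 [H2 _]]. destruct lam_n_bounds as [H3 _]. assert (H4 := ratio_ge).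
  assert (0 <= lam k (S n)) by (rewrite lam_n1; apply Hcone; lia). nra.
Qed.

Lemma lam_n1_nonneg : 0 <= lam k (S n).
Proof. rewrite lam_n1. apply Hcone. lia. Qed.

Lemma lam_n_le j : (j <= n)%nat -> lam k n <= lam k (n - j).
Proof.
  induction j as [|j IH]; intros Hj; [rewrite Nat.sub_0_r; lra|].
  specialize (IH ltac:(lia)).
  rewrite (lam_mid k (n - S j)) by lia. replace (S (n - S j)) with (n - j)%nat by lia.
  assert (H1 := r_ge_1 (S k)). assert (H2 := lam_n1_le_n). assert (H3 := lam_n1_nonneg).
  assert (0 <= lam (S k) (n - j)) by (apply Hcone; lia). nra.
Qed.

Lemma lam_ge_n1 i : (i <= n)%nat -> lam k (S n) <= lam k i.
Proof.
  intros Hi. assert (H := lam_n_le (n - i) ltac:(lia)). replace (n - (n - i))%nat with i in H by lia.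
  assert (H2 := lam_n1_le_n). lra.
Qed.

(** The correction [lam (S k) (S j)] is at most [lam (S k) 0], which equals [lam k (S n)] and so
    does not exceed [lam k (S j)]. *)
Lemma lam_ratio j : (j < n)%nat ->
  IZR (r (S k)) * lam k (S j) <= lam k j <= (IZR (r (S k)) + 1) * lam k (S j).
Proof.
  intros Hj. rewrite (lam_mid k j) by lia.
  destruct (Hcone (S j) ltac:(lia)) as [H1 H2]. rewrite <- lam_n1 in H2.
  assert (H3 := lam_ge_n1 (S j) ltac:(lia)). nra.
Qed.

Lemma lam_antitone i j : (i + j <= n)%nat -> lam k (i + j) <= lam k i.
Proof.
  induction j as [|j IH]; intros Hj; [rewrite Nat.add_0_r; lra|].
  specialize (IH ltac:(lia)). rewrite Nat.add_succ_r.
  destruct (lam_ratio (i + j) ltac:(lia)) as [H1 _].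
  assert (H2 := r_ge_1 (S k)). assert (H3 := lam_ge_n1 (S (i + j)) ltac:(lia)).
  assert (H4 := lam_n1_nonneg). nra.
Qed.

(* The recursion solved for the old vectors has dominant positive coefficients. *)
Lemma cone_step : cone k.
Proof.
  intros i Hi.
  assert (H0 := lam_ge_n1 O ltac:(lia)). assert (H1 := lam_n1_nonneg).
  destruct (Nat.eq_dec i (S n)) as [->|]; [lra|].
  destruct (Nat.eq_dec i (S (S n))) as [->|].
  - rewrite lam_n2. destruct (Hcone (S n) ltac:(lia)). rewrite <- lam_n1 in *. lra.
  - assert (H2 := lam_ge_n1 i ltac:(lia)). assert (H3 := lam_antitone O i ltac:(lia)). simpl in H3. lra.
Qed.

(** The weights are those of [coefficient_bound], so that together they bound the share of all
    vectors after [i0] in L z. The smaller size p_k of v_{k+1} is matched by the additional factor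
    r_k by which its value drops. *)
Lemma lam_tail_le i0 i : (i0 <= n)%nat -> (i0 <= i)%nat -> (i < S (S n))%nat ->
  lam k (S i) * IZR (p (S (S k))) <= 2 * lam k i0 * size k i.
Proof.
  intros Hi0 Hi Hin.
  assert (Hpk := p_ge_1 k). assert (HpS := p_ge_1 (S k)). assert (Hrk := r_ge_1 k).
  destruct K_bounds as [HK1 [HK2 _]]. assert (Hb := ratio_ge).
  assert (Hmu := lam_n1_nonneg).
  assert (Hl := lam_ge_n1 i0 Hi0).
  assert (Hn : IZR (r k) * IZR (r (S k)) * lam k (S n) <= 2 * lam k i0).
  { destruct lam_n_bounds as [H _].
    assert (H1 := lam_antitone i0 (n - i0) ltac:(lia)). replace (i0 + (n - i0))%nat with n in H1 by lia. nra. }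
  destruct (Nat.eq_dec i n) as [->|Hne].
  - rewrite size_n. rewrite !p_S_R. nra.
  - rewrite (size_ne k i Hne), (p_S_R (S k)).
    assert (IZR (r (S k)) * lam k (S i) <= 2 * lam k i0); [|nra].
    destruct (Nat.eq_dec i (S n)) as [->|Hne'].
    + rewrite lam_n2. destruct (Hcone (S n) ltac:(lia)) as [_ H]. rewrite <- lam_n1 in H. nra.
    + destruct (lam_ratio i0 ltac:(lia)) as [H1 _].
      assert (H2 := lam_antitone (S i0) (i - i0) ltac:(lia)).
      replace (S i0 + (i - i0))%nat with (S i) in H2 by lia. nra.
Qed.

Lemma lam_0_bounds j : (j <= n)%nat ->
  IZR (r (S k)) ^ j * lam k n <= lam k (n - j) <= (IZR (r (S k)) + 1) ^ j * lam k n.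
Proof.
  induction j as [|j IH]; intros Hj; [rewrite Nat.sub_0_r; simpl; lra|].
  specialize (IH ltac:(lia)).
  destruct (lam_ratio (n - S j) ltac:(lia)) as [H1 H2]. replace (S (n - S j)) with (n - j)%nat in * by lia.
  simpl pow. assert (H := r_ge_1 (S k)). split; nra.
Qed.

End Step.

(* The product is nearly constant since r_{k+1} grows at least geometrically. *)
Definition normal (k : nat) : R := lam k O * IZR (p k) * IZR (p (S k)) ^ S n.

Lemma pow_le_exp (x : R) (j : nat) : 0 <= x -> (1 + x) ^ j <= exp (INR j * x).
Proof.
  intros Hx. induction j as [|j IH]; [simpl; rewrite Rmult_0_l, exp_0; lra|].
  rewrite S_INR, Rmult_plus_distr_r, Rmult_1_l, exp_plus. simpl pow.
  assert (H := exp_ineq1_le x). assert (0 < (1 + x) ^ j) by (apply pow_lt; lra).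
  rewrite Rmult_comm. apply Rmult_le_compat; lra.
Qed.

Lemma normal_S k : normal (S k) =
  lam k (S n) * (IZR (r k) * IZR (r (S k)) * IZR (r (S k)) ^ n) * (IZR (p k) * IZR (p (S k)) ^ S n).
Proof.
  unfold normal. rewrite <- lam_n1, (p_S_R (S k)), Rpow_mult_distr. simpl pow.
  rewrite (p_S_R k). ring.
Qed.

(** Covers the two deviations of one step: d bounds the exponent in (1 + 1/r_{k+1})^n, and 2 (K + 1)
    comes from 1/(1 - x) <= exp(2x) with x = (K + 1)/(r_k r_{k+1}). *)
Definition drift : R := d + 2 * (IZR K + 1).

Lemma normal_step k : cone (S k) ->
  normal k <= normal (S k) * exp (drift / (IZR M * 2 ^ k)) /\
  normal (S k) <= normal k * exp (drift / (IZR M * 2 ^ k)).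
Proof.
  intros Hc. rewrite normal_S. unfold normal. rewrite Rmult_assoc.
  assert (Hd := d_ge_3). assert (HMd := M_ge_d).
  assert (Hp : 0 < IZR (p k) * IZR (p (S k)) ^ S n).
  { apply Rmult_lt_0_compat; [assert (H := p_ge_1 k); lra|].
    apply pow_lt. assert (H := p_ge_1 (S k)). lra. }
  set (X := IZR (p k) * IZR (p (S k)) ^ S n) in *.
  set (mu := lam k (S n)).
  assert (Hmu : 0 <= mu) by now apply lam_n1_nonneg.
  destruct (lam_n_bounds k Hc) as [Hb1 Hb2]. fold mu in Hb1, Hb2.
  destruct (lam_0_bounds k Hc n ltac:(lia)) as [H1 H2]. rewrite Nat.sub_diag in H1, H2.
  assert (Hrat := ratio_ge k). destruct (K_bounds k) as [HK1 [HK2 _]].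
  assert (Hr := r_S k). assert (H2k := pow2_ge_1 k). assert (Hrk := r_ge_1 k).
  set (a := IZR (r (S k))) in *.
  set (b := IZR (r k) * a) in *.
  assert (Ha : 0 < a ^ n) by (apply pow_lt; lra).
  assert (Hinv : / a <= / (IZR M * 2 ^ k)) by (apply Rinv_le_contravar; [nra | exact Hr]).
  assert (Hinvb : / b <= / a) by (apply Rinv_le_contravar; lra).
  assert (Hb0 : 0 < / b) by (apply Rinv_0_lt_compat; lra).
  set (e := drift / (IZR M * 2 ^ k)).
  assert (He1 : INR n * / a <= e).
  { unfold e, drift, Rdiv. apply Rmult_le_compat; [apply pos_INR | | | exact Hinv].
    - left. apply Rinv_0_lt_compat. lra.
    - unfold d. rewrite !S_INR. lra. }
  assert (He2 : 2 * (IZR K + 1) * / b <= e).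
  { unfold e, drift, Rdiv. apply Rmult_le_compat; lra. }
  split.
  - assert (lam k O <= mu * (b * a ^ n) * exp e).
    { eapply Rle_trans; [exact H2|].
      replace (a + 1) with (a * (1 + / a)) by (field; lra).
      rewrite Rpow_mult_distr.
      assert (Hx : (1 + / a) ^ n <= exp e).
      { eapply Rle_trans; [apply pow_le_exp; lra|].
        destruct He1 as [He1 | ->]; [left; now apply exp_increasing | lra]. }
      assert (0 < (1 + / a) ^ n) by (apply pow_lt; lra).
      replace (mu * (b * a ^ n) * exp e) with (a ^ n * exp e * (b * mu)) by ring.
      apply Rle_trans with (a ^ n * (1 + / a) ^ n * (b * mu)).
      - apply Rmult_le_compat_l; [nra | exact Hb2].
      - apply Rmult_le_compat_r; [nra|]. apply Rmult_le_compat_l; lra. }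
    nra.
  - assert (mu * (b * a ^ n) <= lam k O * exp e).
    { set (x := (IZR K + 1) * / b) in *.
      assert (Hx0 : 0 <= x) by (unfold x; nra).
      assert (Hx1 : x <= 1 / 2).
      { unfold x. apply (Rmult_le_reg_r b); [lra|]. rewrite Rmult_assoc, Rinv_l by lra. lra. }
      (* Since exp e >= 1 + 2x, and (1 - x)(1 + 2x) >= 1 for 0 <= x <= 1/2. *)
      assert (Hx : 1 <= (1 - x) * exp e).
      { assert (H3 := exp_ineq1_le e).
        assert (H4 : 2 * x <= e) by (unfold x; lra). nra. }
      assert (Hbx : b - (IZR K + 1) = b * (1 - x)) by (unfold x; field; lra).
      rewrite Hbx in Hb1.
      apply Rle_trans with (a ^ n * (b * (1 - x) * mu) * exp e).
      - replace (a ^ n * (b * (1 - x) * mu) * exp e) with (mu * (b * a ^ n) * ((1 - x) * exp e)) by ring.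
        rewrite <- (Rmult_1_r (mu * (b * a ^ n))) at 1. apply Rmult_le_compat_l; [|exact Hx].
        apply Rmult_le_pos; [exact Hmu | nra].
      - apply Rmult_le_compat_r; [left; apply exp_pos|].
        eapply Rle_trans; [|exact H1]. apply Rmult_le_compat_l; [lra | exact Hb1]. }
    nra.
Qed.

(** * Forms that meet the cone condition at every level *)

Hypothesis alpha_last : alpha (S (S n)) = 1.
Hypothesis all_cone : forall k, cone k.

Lemma normal_0 : normal O = 1.
Proof.
  unfold normal. rewrite p_S, p_0, r_0.
  rewrite lam_0_0, alpha_last.
  rewrite pow1. ring.
Qed.

(** The accumulated exponents drift / (M 2^j) over j < k, in closed form; their limit 2 drift / M
    gives [spread]. *)
Definition envelope (k : nat) : R := drift / IZR M * (2 - 2 * (1 / 2) ^ k).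

Lemma envelope_S k : envelope (S k) = envelope k + drift / (IZR M * 2 ^ k).
Proof.
  unfold envelope. assert (H2 := M_ge_d). assert (H3 := d_ge_3).
  assert (Hp : 2 ^ k <> 0) by (apply pow_nonzero; lra).
  rewrite <- tech_pow_Rmult. unfold Rdiv. rewrite Rmult_1_l, pow_inv. field. split; [exact Hp | lra].
Qed.

Lemma normal_envelope k : exp (- envelope k) <= normal k <= exp (envelope k).
Proof.
  induction k as [|k [IH1 IH2]].
  - rewrite normal_0. unfold envelope. simpl. replace (drift / IZR M * (2 - 2 * 1)) with 0 by ring.
    rewrite Ropp_0, exp_0. lra.
  - destruct (normal_step k (all_cone (S k))) as [H1 H2].
    rewrite envelope_S, Ropp_plus_distr, !exp_plus.
    set (e := exp (drift / (IZR M * 2 ^ k))) in *.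
    assert (He : 0 < e) by apply exp_pos.
    rewrite exp_Ropp with (x := drift / (IZR M * 2 ^ k)). fold e.
    split.
    + apply (Rmult_le_reg_r e); [exact He|]. rewrite Rmult_assoc, Rinv_l by lra. lra.
    + eapply Rle_trans; [exact H2|]. apply Rmult_le_compat_r; lra.
Qed.

Definition spread : R := exp (2 * drift / IZR M).

Lemma spread_pos : 0 < spread.
Proof. apply exp_pos. Qed.

Lemma normal_bounds k : / spread <= normal k <= spread.
Proof.
  destruct (normal_envelope k) as [H1 H2].
  assert (Hd := d_ge_3). assert (HM := M_ge_d). destruct (K_bounds k) as [HK _].
  assert (He : envelope k <= 2 * drift / IZR M).
  { unfold envelope, Rdiv. assert (Hh : 0 < (1 * / 2) ^ k) by (apply pow_lt; lra).
    assert (0 <= drift * / IZR M).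
    { apply Rle_mult_inv_pos; [unfold drift; lra | lra]. }
    nra. }
  unfold spread. rewrite <- exp_Ropp. split.
  - eapply Rle_trans; [|exact H1]. destruct (Req_dec (envelope k) (2 * drift / IZR M)) as [->|Hne]; [lra|].
    left. apply exp_increasing. lra.
  - eapply Rle_trans; [exact H2|]. destruct (Req_dec (envelope k) (2 * drift / IZR M)) as [->|Hne]; [lra|].
    left. apply exp_increasing. lra.
Qed.

(** The cone condition alone allows the value 0; the lower bound for [normal], which goes back to
    [normal_0], excludes it. *)
Lemma lam_0_pos k : 0 < lam k O.
Proof.
  destruct (normal_bounds k) as [H _]. assert (H0 := Rinv_0_lt_compat _ spread_pos).
  unfold normal in H.
  assert (Hp := p_ge_1 k).
  assert (Hq : 0 < IZR (p (S k)) ^ S n) by (apply pow_lt; assert (H1 := p_ge_1 (S k)); lra).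
  destruct (Rlt_le_dec 0 (lam k O)) as [h|h]; [exact h|]. exfalso.
  assert (lam k O * IZR (p k) <= 0) by nra. nra.
Qed.

Lemma lam_n1_pos k : 0 < lam k (S n).
Proof. rewrite lam_n1. apply lam_0_pos. Qed.

(** The factor 4 outlasts the loss of 2 in [lead_coefficient]: a nonzero coefficient at an index up
    to n makes |L z| exceed the value at v_{k+1}. *)
Lemma lam_gap k i : (i <= n)%nat -> 4 * lam k (S n) <= lam k i.
Proof.
  intros Hi. destruct (lam_n_bounds k (all_cone (S k))) as [H _].
  assert (H1 := lam_n_le k (all_cone (S k)) (n - i) ltac:(lia)). replace (n - (n - i))%nat with i in H1 by lia.
  assert (H2 := lam_n1_pos k). destruct (K_bounds k) as [H3 [H4 _]]. assert (H5 := ratio_ge k). nra.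
Qed.

(* Along the indices [0, ..., n] the values [lam k i] decrease so fast that the first nonzero coefficient
   determines the size of [L z]. *)
Lemma lead_coefficient k (m : nat -> Z) (z : zvec) (i0 : nat) :
  (forall c, (c < S (S (S n)))%nat ->
    IZR (z c) = rsum (S (S (S n))) (fun i => IZR (m i) * IZR (basis k i c))) ->
  (forall c, (c < S (S n))%nat -> Rabs (IZR (z c)) <= 2 * d * IZR (p (S k))) ->
  (i0 <= n)%nat -> (forall i, (i < i0)%nat -> m i = 0%Z) -> m i0 <> 0%Z ->
  lam k i0 / 2 <= Rabs (L z).
Proof.
  intros Hz Hzc Hi0 Hlow Hne.
  assert (Hd := d_ge_3). assert (HMd := M_ge_d).
  assert (Hp := p_ge_1 (S k)). assert (Hpk := p_ge_1 k). assert (Hps := p_le_S k).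
  assert (HpM := p_SS_ge k).
  set (a := Rabs (IZR (m i0))).
  assert (Ha : 1 <= a).
  { unfold a. rewrite <- abs_IZR. apply IZR_le. lia. }
  (* The coefficient of v_k, which [coefficient_bound] does not control, is either the leading one
     or zero. *)
  assert (Hm0 : Rabs (IZR (m O)) <= a).
  { destruct i0 as [|i0]; [unfold a; lra|]. rewrite Hlow by lia. rewrite Rabs_R0. lra. }
  set (q := IZR (p (S k))) in *.
  assert (HN := coefficient_bound k m z (2 * d * q + 2 * a * q) ltac:(nra) Hz).
  lapply HN; clear HN; [intros HN|].
  2: { intros c Hc. unfold Rminus. eapply Rle_trans; [apply Rabs_triang|].
       rewrite Rabs_Ropp, Rabs_mult. specialize (Hzc c Hc).
       destruct (basis_near k) as [H0 _]. specialize (H0 c ltac:(lia)).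
       assert (H1 := Rabs_pos (IZR (m O))). assert (H2 := Rabs_pos (IZR (basis k O c))). nra. }
  set (N := rsum (S (S n)) (fun i => Rabs (IZR (m (S i))) * size k i)) in *.
  set (q2 := IZR (p (S (S k)))) in *.
  assert (Hl0 : 0 <= lam k i0) by (apply all_cone; lia).
  assert (Hcomb := L_comb m (S (S (S n))) (basis k) z Hz).
  set (rest := rsum (S (S (S n))) (fun i => if (i =? i0)%nat then 0 else IZR (m i) * L (basis k i))).
  assert (Hsplit : L z = IZR (m i0) * L (basis k i0) + rest).
  { rewrite Hcomb. unfold rest.
    rewrite (rsum_ext _ (fun i => IZR (m i) * L (basis k i))
      (fun i => (if (i =? i0)%nat then IZR (m i) * L (basis k i) else 0) +
                (if (i =? i0)%nat then 0 else IZR (m i) * L (basis k i)))).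
    - rewrite rsum_plus. f_equal. rewrite (rsum_single _ _ i0).
      + now rewrite Nat.eqb_refl.
      + lia.
      + intros i _ Hi. destruct (Nat.eqb_spec i i0); [lia | reflexivity].
    - intros i _. destruct (i =? i0)%nat; ring. }
  assert (Hrest : Rabs rest * q2 <= 2 * lam k i0 * N).
  { unfold rest. rewrite rsum_succ_l.
    assert (Hz0 : (if (0 =? i0)%nat then 0 else IZR (m O) * L (basis k O)) = 0).
    { destruct i0; [reflexivity|]. rewrite Hlow by lia. simpl. ring. }
    rewrite Hz0, Rplus_0_l.
    apply Rle_trans with (rsum (S (S n)) (fun i => Rabs (if (S i =? i0)%nat then 0 else IZR (m (S i)) * L (basis k (S i)))) * q2).
    { apply Rmult_le_compat_r; [unfold q2; assert (H := p_ge_1 (S (S k))); lra | apply rsum_Rabs]. }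
    rewrite Rmult_comm. unfold N. rewrite <- !rsum_scal. apply rsum_le. intros i Hi.
    assert (Hmi := Rabs_pos (IZR (m (S i)))). assert (Hsi := size_pos k i).
    destruct (Nat.eqb_spec (S i) i0) as [e|e].
    { rewrite Rabs_R0. rewrite Rmult_0_r. apply Rmult_le_pos; nra. }
    destruct (Nat.lt_ge_cases i i0) as [Hlt|Hge].
    { rewrite Hlow by lia. rewrite Rmult_0_l, Rabs_R0. lra. }
    rewrite Rabs_mult, Rabs_L_basis, (Rabs_pos_eq (lam k (S i))) by (apply all_cone; lia).
    assert (H := lam_tail_le k (all_cone (S k)) i0 i Hi0 Hge Hi). fold q2 in H. nra. }
  assert (Hrest2 : Rabs rest <= lam k i0 * a / 2).
  (* N is at most 2d (2 d q + 2 a q) with a >= 1, while p_{k+2} >= M q >= 1000 d^2 q. *)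
  { assert (HNq : 4 * N <= a * q2).
    { assert (Hq : 1000 * d ^ 2 * q <= q2).
      { eapply Rle_trans; [apply Rmult_le_compat_r; [lra | exact M_ge] | exact HpM]. }
      assert (Hdd : 3 * d * (a * q) <= d ^ 2 * (a * q)) by (apply Rmult_le_compat_r; nra).
      assert (Hq1 : d ^ 2 * q * 1 <= d ^ 2 * q * a) by (apply Rmult_le_compat_l; nra).
      assert (Hq2 : a * (1000 * d ^ 2 * q) <= a * q2) by (apply Rmult_le_compat_l; lra).
      nra. }
    apply (Rmult_le_reg_r q2); [unfold q2; assert (H := p_ge_1 (S (S k))); lra|]. nra. }
  assert (Hmain : Rabs (IZR (m i0) * L (basis k i0)) = a * lam k i0).
  { rewrite Rabs_mult, Rabs_L_basis, (Rabs_pos_eq (lam k i0)) by exact Hl0. reflexivity. }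
  assert (Htri : Rabs (IZR (m i0) * L (basis k i0)) <= Rabs (L z) + Rabs rest).
  { replace (IZR (m i0) * L (basis k i0)) with (L z + - rest) by (rewrite Hsplit; ring).
    eapply Rle_trans; [apply Rabs_triang|]. rewrite Rabs_Ropp. lra. }
  nra.
Qed.

(** * Best approximations *)

Definition hnorm (z : zvec) : R := rnorm (S (S n)) (zR z).

(* v_{k+1} in the notation of the header, of size p_k. *)
Definition bv (k : nat) : zvec := basis k (S n).

Lemma bv_S k c : bv (S k) c = basis k (S (S n)) c.
Proof. apply basis_S_n1. Qed.

Lemma bv_near k c : (c < S (S (S n)))%nat ->
  Rabs (IZR (bv k c) - IZR (p k) * unit_at (target k n) c) <= defect k * IZR (p k).
Proof. intros Hc. destruct (basis_near k) as [_ H]. specialize (H n c ltac:(lia) Hc). now rewrite size_n in H. Qed.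

Lemma bv_abs_le k c : (c < S (S (S n)))%nat -> Rabs (IZR (bv k c)) <= 2 * IZR (p k).
Proof.
  intros Hc. assert (H := p_ge_1 k).
  eapply near_abs_le; [| | |apply bv_near, Hc]; [lra | apply defect_le_1 | apply unit_at_bounds].
Qed.

Lemma bv_target_ge k : IZR (p k) * (23 / 24) <= Rabs (IZR (bv k (target k n))).
Proof.
  assert (Ht := target_lt k n ltac:(lia)).
  assert (H := bv_near k (target k n) ltac:(lia)).
  unfold unit_at in H. rewrite Nat.eqb_refl in H.
  assert (He := defect_le_1 k). assert (Hp := p_ge_1 k).
  assert (H1 : IZR (p k) * 1 = IZR (bv k (target k n)) + - (IZR (bv k (target k n)) - IZR (p k) * 1)) by ring.
  apply (f_equal Rabs) in H1. rewrite Rabs_pos_eq in H1 by lra.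
  assert (H2 := Rabs_triang (IZR (bv k (target k n))) (- (IZR (bv k (target k n)) - IZR (p k) * 1))).
  rewrite Rabs_Ropp in H2. nra.
Qed.

Lemma hnorm_bv_ge k : IZR (p k) * (23 / 24) <= hnorm (bv k).
Proof.
  eapply Rle_trans; [apply bv_target_ge|].
  apply (Rabs_le_rnorm (S (S n)) (zR (bv k))). apply target_lt. lia.
Qed.

Lemma hnorm_bv_le k : hnorm (bv k) <= 2 * d * IZR (p k).
Proof.
  assert (Hp := p_ge_1 k).
  apply Rle_trans with (INR (S (S n)) * (2 * IZR (p k))).
  - apply rnorm_le; [lra|]. intros c Hc. apply bv_abs_le. lia.
  - unfold d. rewrite (S_INR (S (S n))). lra.
Qed.

(** Expanding v_{k+3} against v_{k+2} leaves a nonnegative multiple of the previous product, the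
    term K |v_{k+2}|^2 >= 16 d (23/24)^2 p_{k+1}^2, and the product with w_n, which is at least -4 d
    p_{k+1}^2. At the start the two vectors are different unit vectors. *)
Lemma bv_inner_nonneg k : 0 <= rsum (S (S n)) (fun c => IZR (bv k c) * IZR (bv (S k) c)).
Proof.
  induction k as [|k IH].
  - apply rsum_nonneg. intros c _. rewrite bv_S. unfold bv. cbn [basis].
    destruct (c =? n)%nat, (c =? S n)%nat; lra.
  - assert (Hd := d_ge_3). assert (Hp := p_ge_1 (S k)).
    rewrite (rsum_ext _ _ (fun c => IZR (r k) * IZR (r (S k)) * (IZR (bv k c) * IZR (bv (S k) c)) +
      (IZR K * (IZR (bv (S k) c) * IZR (bv (S k) c)) + IZR (bv (S k) c) * IZR (basis k n c)))).
    2: { intros c _. rewrite (bv_S (S k)), basis_S_n2, !plus_IZR, !mult_IZR, <- bv_S. unfold bv. ring. }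
    rewrite !rsum_plus, !rsum_scal.
    assert (H1 : (IZR (p (S k)) * (23 / 24)) * (IZR (p (S k)) * (23 / 24)) <=
                 rsum (S (S n)) (fun c => IZR (bv (S k) c) * IZR (bv (S k) c))).
    { eapply Rle_trans; [|apply (rsum_term_le _ (fun c => IZR (bv (S k) c) * IZR (bv (S k) c)) (target (S k) n))].
      - assert (H := bv_target_ge (S k)).
        rewrite <- (Rabs_pos_eq (IZR (bv (S k) (target (S k) n)) * IZR (bv (S k) (target (S k) n)))) by nra.
        rewrite Rabs_mult. apply Rmult_le_compat; lra.
      - intros. nra.
      - apply target_lt. lia. }
    assert (H2 : - (d * (2 * IZR (p (S k)) * (2 * IZR (p (S k))))) <=
                 rsum (S (S n)) (fun c => IZR (bv (S k) c) * IZR (basis k n c))).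
    { apply Rle_trans with (- Rabs (rsum (S (S n)) (fun c => IZR (bv (S k) c) * IZR (basis k n c)))).
      2: { unfold Rabs. destruct (Rcase_abs _); lra. }
      apply Ropp_le_contravar. eapply Rle_trans; [apply rsum_Rabs|].
      apply Rle_trans with (INR (S (S n)) * (2 * IZR (p (S k)) * (2 * IZR (p (S k))))).
      - apply rsum_le_const. intros c Hc. rewrite Rabs_mult.
        apply Rmult_le_compat; try apply Rabs_pos; [apply bv_abs_le; lia | apply basis_abs_le; lia].
      - unfold d. rewrite (S_INR (S (S n))). nra. }
    assert (H3 := r_ge_1 k). assert (H4 := r_ge_1 (S k)).
    assert (H5 : 0 <= IZR (r k) * IZR (r (S k)) * rsum (S (S n)) (fun i => IZR (bv k i) * IZR (bv (S k) i))).
    { apply Rmult_le_pos; [nra | exact IH]. }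
    rewrite K_eq. nra.
Qed.

Lemma Rabs_L_bv k : Rabs (L (bv k)) = lam (S k) O.
Proof. unfold bv. rewrite Rabs_L_basis, lam_n1. apply Rabs_pos_eq. left. apply lam_0_pos. Qed.

Lemma lam_0_lt k : lam (S k) O < lam k O.
Proof. assert (H := lam_gap k O ltac:(lia)). rewrite lam_n1 in H. assert (H1 := lam_0_pos (S k)). lra. Qed.

(* The signs of [L (bv k)] alternate while consecutive [bv k] make a non-obtuse angle:
   this excludes [bv (S k) - bv k] and [bv (S k) + bv k]. *)
Lemma best_candidates k (z : zvec) :
  hnorm z <= hnorm (bv (S k)) -> Rabs (L z) <= lam (S k) O ->
  exists e : Z, (-1 <= e <= 1)%Z /\
    ((forall c, (c < S (S (S n)))%nat -> z c = (e * bv k c)%Z) \/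
     (forall c, (c < S (S (S n)))%nat -> z c = (e * bv (S k) c)%Z)).
Proof.
  intros Hh HL. destruct (spanned_all k z) as [m Hm].
  assert (Hzc : forall c, (c < S (S n))%nat -> Rabs (IZR (z c)) <= 2 * d * IZR (p (S k))).
  { intros c Hc. eapply Rle_trans; [apply (Rabs_le_rnorm (S (S n)) (zR z) c Hc)|].
    assert (H := hnorm_bv_le (S k)). fold (hnorm z). lra. }
  (* The first nonzero coefficient at an index i <= n would give |L z| >= [lam k i / 2] >= 2
     [lam (S k) 0]. Hence z lies in the plane of [bv k] and [bv (S k)]. *)
  assert (Hlow : forall j i, (i < j)%nat -> (i <= n)%nat -> m i = 0%Z).
  { induction j as [|j IH]; intros i Hij Hi; [lia|].
    destruct (Z.eq_dec (m i) 0) as [e|e]; [exact e|]. exfalso.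
    assert (H := lead_coefficient k m z i Hm Hzc Hi (fun i' Hi' => IH i' ltac:(lia) ltac:(lia)) e).
    assert (H1 := lam_gap k i Hi). rewrite lam_n1 in H1. assert (H2 := lam_0_pos (S k)). lra. }
  set (a := m (S n)). set (b := m (S (S n))).
  assert (Hz : forall c, (c < S (S (S n)))%nat -> z c = (a * bv k c + b * bv (S k) c)%Z).
  { intros c Hc. apply eq_IZR. rewrite Hm by exact Hc.
    change (rsum (S (S (S n))) ?f) with (rsum (S n) f + f (S n) + f (S (S n))). cbv beta.
    rewrite rsum_zero.
    - rewrite plus_IZR, !mult_IZR, bv_S. unfold a, b, bv. ring.
    - intros i Hi. rewrite (Hlow (S n) i) by lia. ring. }
  assert (HLz : Rabs (L z) = Rabs (IZR a * lam (S k) O - IZR b * lam (S (S k)) O)).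
  { rewrite (L_lin (IZR a) (IZR b) 0 (bv k) (bv (S k)) (bv k) z).
    2: { intros c Hc. rewrite Hz, plus_IZR, !mult_IZR by exact Hc. ring. }
    rewrite <- (lam_n1 k), <- (lam_n1 (S k)). unfold lam. rewrite !Nat.eqb_refl. fold (bv k) (bv (S k)).
    replace (IZR a * ((-1) ^ k * -1 * L (bv k)) - IZR b * ((-1) ^ S k * -1 * L (bv (S k))))
      with ((-1) ^ S k * (IZR a * L (bv k) + IZR b * L (bv (S k)) + 0 * L (bv k))) by (simpl pow; ring).
    rewrite Rabs_mult, pow_1_abs. ring. }
  assert (Hnz : hnorm z * hnorm z <= hnorm (bv (S k)) * hnorm (bv (S k))).
  { apply Rmult_le_compat; try assumption; apply rnorm_nonneg. }
  unfold hnorm in Hnz. rewrite !rnorm_sqr in Hnz. unfold zR in Hnz.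
  rewrite (rsum_ext _ (fun c => IZR (z c) * IZR (z c))
    (fun c => (IZR a * IZR a) * (IZR (bv k c) * IZR (bv k c)) +
      ((2 * (IZR a * IZR b)) * (IZR (bv k c) * IZR (bv (S k) c)) +
       (IZR b * IZR b) * (IZR (bv (S k) c) * IZR (bv (S k) c))))) in Hnz.
  2: { intros c Hc. rewrite Hz, plus_IZR, !mult_IZR by lia. ring. }
  rewrite !rsum_plus, !rsum_scal in Hnz.
  assert (Hxy := bv_inner_nonneg k).
  assert (Hpos : forall j, 0 < rsum (S (S n)) (fun c => IZR (bv j c) * IZR (bv j c))).
  { intros j. change (0 < rsum (S (S n)) (fun c => zR (bv j) c * zR (bv j) c)). rewrite <- rnorm_sqr.
    assert (H := hnorm_bv_ge j). fold (hnorm (bv j)). assert (H1 := p_ge_1 j). nra. }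
  assert (Hx := Hpos k). assert (Hy := Hpos (S k)).
  set (xx := rsum (S (S n)) (fun c => IZR (bv k c) * IZR (bv k c))) in *.
  set (xy := rsum (S (S n)) (fun c => IZR (bv k c) * IZR (bv (S k) c))) in *.
  set (yy := rsum (S (S n)) (fun c => IZR (bv (S k) c) * IZR (bv (S k) c))) in *.
  rewrite HLz in HL. clear HLz Hm Hlow Hzc Hh.
  assert (Hm1 := lam_0_pos (S k)). assert (Hm2 := lam_0_pos (S (S k))).
  set (l1 := lam (S k) O) in *. set (l2 := lam (S (S k)) O) in *.
  assert (HL1 : - l1 <= IZR a * l1 - IZR b * l2 <= l1).
  { revert HL. unfold Rabs. destruct (Rcase_abs _); lra. }
  assert (Ha : (a = 0 \/ 1 <= a \/ a <= -1)%Z) by lia.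
  assert (Hb : (b = 0 \/ 1 <= b \/ b <= -1)%Z) by lia.
  (* Coefficients of equal sign violate the norm bound, since then the squared norm of z is at least
     [xx + yy]; opposite signs violate the bound on the form, since then |L z| >= [l1 + l2]. *)
  assert (Hab : a = 0%Z \/ b = 0%Z).
  { destruct Ha as [Ha|[Ha|Ha]]; [now left | |]; destruct Hb as [Hb|[Hb|Hb]];
      try (now right); exfalso; apply IZR_le in Ha; apply IZR_le in Hb.
    - assert (1 <= IZR a * IZR b) by nra. assert (1 <= IZR a * IZR a) by nra.
      assert (1 <= IZR b * IZR b) by nra.
      assert (yy <= IZR b * IZR b * yy) by nra. assert (xx <= IZR a * IZR a * xx) by nra.
      assert (0 <= 2 * (IZR a * IZR b) * xy) by nra. lra.
    - nra.
    - nra.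
    - assert (1 <= IZR a * IZR b) by nra. assert (1 <= IZR a * IZR a) by nra.
      assert (1 <= IZR b * IZR b) by nra.
      assert (yy <= IZR b * IZR b * yy) by nra. assert (xx <= IZR a * IZR a * xx) by nra.
      assert (0 <= 2 * (IZR a * IZR b) * xy) by nra. lra. }
  destruct Hab as [E|E].
  - exists b. split.
    + rewrite E in Hnz. rewrite !Rmult_0_l, Rmult_0_r in Hnz.
      assert (IZR b * IZR b <= 1) by nra.
      rewrite <- mult_IZR in H. apply le_IZR in H. nia.
    + right. intros c Hc. rewrite Hz, E by exact Hc. ring.
  - exists a. split.
    + rewrite E, Rmult_0_l in HL1. assert (-1 <= IZR a <= 1) by nra.
      destruct H as [H1 H2]. apply le_IZR in H1, H2. lia.
    + left. intros c Hc. rewrite Hz, E by exact Hc. ring.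
Qed.

Lemma hnorm_ext (x y : zvec) : (forall c, (c < S (S (S n)))%nat -> x c = y c) -> hnorm x = hnorm y.
Proof. intros H. apply rnorm_ext. intros c Hc. unfold zR. now rewrite H by lia. Qed.

Lemma hnorm_scal (e : Z) (x : zvec) : hnorm (fun c => (e * x c)%Z) = Rabs (IZR e) * hnorm x.
Proof.
  unfold hnorm. rewrite <- rnorm_scal. apply rnorm_ext. intros c _. unfold zR. apply mult_IZR.
Qed.

Lemma L_scal (e : Z) (x : zvec) : L (fun c => (e * x c)%Z) = IZR e * L x.
Proof.
  rewrite (L_lin (IZR e) 0 0 x x x).
  - ring.
  - intros c _. rewrite mult_IZR. ring.
Qed.

Lemma unit_or_zero (e : Z) : (-1 <= e <= 1)%Z -> e = 0%Z \/ Rabs (IZR e) = 1.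
Proof.
  intros He. assert (e = 0 \/ e = 1 \/ e = -1)%Z as [-> | [-> | ->]] by lia.
  - now left.
  - right. apply Rabs_R1.
  - right. rewrite Rabs_left; lra.
Qed.

Lemma hnorm_pos_ge_1 (z : zvec) : hnorm z <> 0 -> 1 <= hnorm z.
Proof.
  intros Hz.
  destruct (classic (exists c, (c < S (S n))%nat /\ z c <> 0%Z)) as [[c [Hc Hzc]]|Hno].
  - eapply Rle_trans; [|apply (Rabs_le_rnorm (S (S n)) (zR z) c Hc)].
    unfold zR. rewrite <- abs_IZR. apply IZR_le. lia.
  - exfalso. apply Hz. unfold hnorm.
    assert (H := rnorm_le (S (S n)) (zR z) 0 ltac:(lra)).
    assert (H1 := rnorm_nonneg (S (S n)) (zR z)).
    assert (H2 : rnorm (S (S n)) (zR z) <= INR (S (S n)) * 0).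
    { apply H. intros c Hc. unfold zR. destruct (Z.eq_dec (z c) 0) as [->|h].
      - rewrite Rabs_R0. lra.
      - exfalso. apply Hno. now exists c. }
    lra.
Qed.

Lemma p_unbounded k : INR k <= IZR (p (S k)).
Proof.
  induction k as [|k IH]; [simpl INR; assert (H := p_ge_1 1); lra|].
  rewrite S_INR. assert (H := p_SS_ge k). assert (H1 := p_ge_1 (S k)).
  assert (H2 := M_ge_d). assert (H3 := d_ge_3). nra.
Qed.

Lemma first_index (P : nat -> Prop) (k : nat) : P k ->
  exists j, P j /\ (j = O \/ exists i, j = S i /\ ~ P i).
Proof.
  induction k as [|k IH]; intros Hk; [exists O; tauto|].
  destruct (classic (P k)) as [h|h]; [now apply IH | exists (S k); eauto].
Qed.

Lemma exists_p_ge (X : R) : exists k, X <= IZR (p (S k)).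
Proof.
  destruct (INR_unbounded X) as [k Hk]. exists k. assert (H := p_unbounded k). lra.
Qed.

Lemma hnorm_bv_0 : hnorm (bv 0) <= 1.
Proof.
  unfold hnorm, rnorm. rewrite <- sqrt_1. apply sqrt_le_1_alt.
  rewrite (rsum_single (S (S n)) _ n ltac:(lia)); unfold zR, bv; cbn [basis].
  - rewrite Nat.eqb_refl. lra.
  - intros c _ Hc. destruct (Nat.eqb_spec c n); [lia | lra].
Qed.

(** Of the candidates, multiples of [bv k] have value 0 in norm or a larger form, so only [bv (S k)]
    and its opposite remain. The index starts at 1 because [bv 0] and [bv 1] are unit vectors of
    equal norm and the form is smaller at [bv 1]. *)
Lemma best_approx_bv k : best_approx (S (S (S n))) alpha (bv (S k)).
Proof.
  change (hnorm (bv (S k)) <> 0 /\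
    (forall z, 0 < hnorm z <= hnorm (bv (S k)) -> Rabs (L (bv (S k))) <= Rabs (L z)) /\
    (forall z, 0 < hnorm z < hnorm (bv (S k)) -> Rabs (L (bv (S k))) < Rabs (L z))).
  assert (Hl1 := lam_0_lt (S k)). assert (Hl2 := lam_0_pos (S (S k))).
  assert (Hh := hnorm_bv_ge (S k)). assert (Hp := p_ge_1 (S k)).
  assert (Hc : forall z, 0 < hnorm z <= hnorm (bv (S k)) -> Rabs (L z) <= lam (S (S k)) O ->
    Rabs (L z) = lam (S (S k)) O /\ hnorm z = hnorm (bv (S k))).
  { intros z Hz HL.
    destruct (best_candidates k z (proj2 Hz) ltac:(lra)) as [e [He H]].
    destruct H as [H|H]; rewrite (L_ext _ _ H) in *; rewrite (hnorm_ext _ _ H) in *;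
      rewrite L_scal in *; rewrite hnorm_scal in *; rewrite Rabs_mult, Rabs_L_bv in *;
      destruct (unit_or_zero e He) as [->|E]; try (rewrite Rabs_R0 in Hz; lra); rewrite E in *.
    - lra.
    - lra. }
  rewrite Rabs_L_bv. repeat split; [lra | |].
  - intros z Hz. destruct (Rle_dec (lam (S (S k)) O) (Rabs (L z))) as [h|h]; [exact h|].
    destruct (Hc z Hz ltac:(lra)). lra.
  - intros z Hz. destruct (Rlt_dec (lam (S (S k)) O) (Rabs (L z))) as [h|h]; [exact h|].
    destruct (Hc z ltac:(lra) ltac:(lra)). lra.
Qed.

(** Take the first k for which z is no longer than [bv (S k)]. Then [bv k] is no longer than z, so
    minimality gives |L z| <= |L (bv k)|, and [best_candidates] applies; for k = 0 the comparison
    uses that nonzero integer vectors have norm at least 1. *)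
Lemma best_approx_is_bv (z : zvec) : best_approx (S (S (S n))) alpha z ->
  exists (k : nat) (e : Z), (e = 1 \/ e = -1)%Z /\ forall c, (c < S (S (S n)))%nat -> z c = (e * bv k c)%Z.
Proof.
  intros Hbest.
  change (hnorm z <> 0 /\
    (forall z', 0 < hnorm z' <= hnorm z -> Rabs (L z) <= Rabs (L z')) /\
    (forall z', 0 < hnorm z' < hnorm z -> Rabs (L z) < Rabs (L z'))) in Hbest.
  destruct Hbest as [Hnz [Hmin _]].
  assert (Hz1 := hnorm_pos_ge_1 z Hnz).
  destruct (exists_p_ge (2 * hnorm z)) as [k0 Hk0].
  destruct (first_index (fun k => hnorm z <= hnorm (bv (S k))) k0) as [k [Hk Hfirst]].
  { assert (H := hnorm_bv_ge (S k0)). lra. }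
  assert (Hbv : 0 < hnorm (bv k) <= hnorm z).
  { split; [assert (H := hnorm_bv_ge k); assert (H1 := p_ge_1 k); lra|].
    destruct Hfirst as [->|[j [-> Hj]]]; [assert (H := hnorm_bv_0); lra | lra]. }
  assert (HL := Hmin (bv k) Hbv). rewrite Rabs_L_bv in HL.
  destruct (best_candidates k z Hk HL) as [e [He H]].
  assert (He0 : e <> 0%Z).
  { intros ->. apply Hnz. destruct H as [H|H]; rewrite (hnorm_ext _ _ H), hnorm_scal, Rabs_R0; ring. }
  destruct H as [H|H]; [exists k, e | exists (S k), e]; (split; [lia | exact H]).
Qed.

(** The small value of the form rules out v_k. Every other basis vector except v_{k+1} has size
    p_{k+1}, which by [coefficient_bound] is too long to occur in so short a z. *)
Lemma multiple_of_bv k (z : zvec) :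
  hnorm z * (4 * d) <= IZR (p (S k)) -> Rabs (L z) < lam k O / 2 ->
  exists a : Z, forall c, (c < S (S (S n)))%nat -> z c = (a * bv k c)%Z.
Proof.
  intros Hh HL. destruct (spanned_all k z) as [m Hm].
  assert (Hd := d_ge_3). assert (Hp := p_ge_1 (S k)).
  assert (Hzc : forall c, (c < S (S n))%nat -> Rabs (IZR (z c)) <= hnorm z).
  { intros c Hc. apply (Rabs_le_rnorm (S (S n)) (zR z) c Hc). }
  assert (Hh0 : 0 <= hnorm z) by apply rnorm_nonneg.
  assert (Hm0 : m O = 0%Z).
  { destruct (Z.eq_dec (m O) 0) as [e|e]; [exact e|]. exfalso.
    assert (H := lead_coefficient k m z O Hm).
    assert (lam k O / 2 <= Rabs (L z)); [|lra].
    apply H; [|lia | intros; lia | exact e].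
    intros c Hc. specialize (Hzc c Hc). nra. }
  assert (HN := coefficient_bound k m z (hnorm z) Hh0 Hm).
  lapply HN; clear HN; [intros HN|].
  2: { intros c Hc. rewrite Hm0, Rmult_0_l, Rminus_0_r. now apply Hzc. }
  exists (m (S n)). intros c Hc. apply eq_IZR. rewrite Hm by exact Hc.
  rewrite (rsum_single (S (S (S n))) _ (S n) ltac:(lia)); [symmetry; apply mult_IZR|].
  intros i Hi Hne.
  assert (m i = 0%Z) as ->; [|ring].
  destruct i as [|i]; [exact Hm0|].
  assert (H : Rabs (IZR (m (S i))) * size k i <= 2 * d * hnorm z).
  { eapply Rle_trans; [|exact HN].
    apply (rsum_term_le (S (S n)) (fun i => Rabs (IZR (m (S i))) * size k i)); [|lia].
    intros j _. apply Rmult_le_pos; [apply Rabs_pos | assert (H := size_pos k j); lra]. }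
  rewrite size_ne in H by lia.
  destruct (Z.eq_dec (m (S i)) 0) as [e|e]; [exact e|]. exfalso.
  assert (1 <= Rabs (IZR (m (S i)))) by (rewrite <- abs_IZR; apply IZR_le; lia).
  nra.
Qed.

Definition fnorm (z : zvec) : R := znorm (S (S (S n))) z.

Lemma hnorm_le_fnorm z : hnorm z <= fnorm z.
Proof.
  apply sqrt_le_1_alt.
  change (rsum (S (S (S n))) ?f) with (rsum (S (S n)) f + f (S (S n))). cbv beta. unfold zR. nra.
Qed.

Lemma fnorm_bv_ge k : IZR (p k) * (23 / 24) <= fnorm (bv k).
Proof. eapply Rle_trans; [apply hnorm_bv_ge | apply hnorm_le_fnorm]. Qed.

Lemma fnorm_bv_le k : fnorm (bv k) <= 2 * d * IZR (p k).
Proof.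
  assert (Hp := p_ge_1 k).
  apply Rle_trans with (d * (2 * IZR (p k))); [|lra].
  apply rnorm_le; [lra|]. intros c Hc. now apply bv_abs_le.
Qed.

Lemma fnorm_sign (e : Z) (x z : zvec) : (e = 1 \/ e = -1)%Z ->
  (forall c, (c < S (S (S n)))%nat -> z c = (e * x c)%Z) -> fnorm z = fnorm x.
Proof.
  intros He H. unfold fnorm, znorm, rnorm. f_equal. apply rsum_ext. intros c Hc. unfold zR.
  rewrite H, mult_IZR by exact Hc. destruct He as [-> | ->]; ring.
Qed.

Lemma L_sign (e : Z) (x z : zvec) : (e = 1 \/ e = -1)%Z ->
  (forall c, (c < S (S (S n)))%nat -> z c = (e * x c)%Z) -> Rabs (L z) = Rabs (L x).
Proof.
  intros He H. rewrite (L_ext _ _ H), L_scal, Rabs_mult.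
  destruct (unit_or_zero e ltac:(lia)) as [->|E]; [lia | rewrite E; ring].
Qed.

(** * Exponents *)

Section Exponents.
Variables (beta C : R).
Hypothesis beta_pos : 0 < beta.
Hypothesis C_pos : 0 < C.
Hypothesis growth : forall k,
  Rpower (IZR (p k)) (1 + beta) <= IZR (p (S k)) <= C * Rpower (IZR (p k)) (1 + beta).

(* d - 1 + f_d(beta), see [f_d_exponent]. *)
Definition exponent : R := (1 + beta) + INR (S n) * (1 + beta) ^ 2.

Lemma Rpower_pos x y : 0 < Rpower x y.
Proof. apply exp_pos. Qed.

(** By [normal_bounds] the value is of order 1/(p_{k+1} p_{k+2}^{n+1}), where p_{k+1} and p_{k+2}
    are of orders p_k^t and p_k^(t^2). *)
Lemma lam_power : exists c1 c2, 0 < c1 /\ 0 < c2 /\ forall k,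
  c1 * Rpower (IZR (p k)) (- exponent) <= lam (S k) O <= c2 * Rpower (IZR (p k)) (- exponent).
Proof.
  set (t := 1 + beta) in *. assert (Hs := spread_pos).
  (* The growth bound applied twice: p_{k+2} <= C (C P)^t with P = p_k^t. *)
  set (C2 := C * Rpower C t).
  assert (HC2 : 0 < C2) by (apply Rmult_lt_0_compat; [exact C_pos | apply Rpower_pos]).
  assert (HC2n : 0 < C2 ^ S n) by now apply pow_lt.
  exists (/ (spread * (C * C2 ^ S n))), spread.
  split; [apply Rinv_0_lt_compat; apply Rmult_lt_0_compat; nra|]. split; [exact Hs|].
  intros k.
  assert (Hp := p_ge_1 k). assert (Hp1 := p_ge_1 (S k)). assert (Hp2 := p_ge_1 (S (S k))).
  destruct (growth k) as [G1 G2]. destruct (growth (S k)) as [G3 G4]. fold t in G1, G2, G3, G4.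
  set (P := Rpower (IZR (p k)) t) in *.
  assert (HP : 0 < P) by apply Rpower_pos.
  assert (G5 : Rpower P t <= IZR (p (S (S k)))).
  { eapply Rle_trans; [|exact G3]. apply Rle_Rpower_l; unfold t; lra. }
  assert (G6 : IZR (p (S (S k))) <= C2 * Rpower P t).
  { eapply Rle_trans; [exact G4|]. unfold C2. rewrite Rmult_assoc, Rpower_mult_distr by assumption.
    apply Rmult_le_compat_l; [lra|]. apply Rle_Rpower_l; unfold t; lra. }
  assert (HPt := Rpower_pos P t).
  assert (HE : Rpower (IZR (p k)) (- exponent) = / (P * Rpower P t ^ S n)).
  { rewrite Rpower_Ropp. f_equal. unfold exponent. fold t. rewrite Rpower_plus. fold P. f_equal.
    rewrite <- (Rpower_pow (S n) (Rpower P t)) by exact HPt. unfold P. rewrite !Rpower_mult. f_equal. ring. }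
  rewrite HE.
  destruct (normal_bounds (S k)) as [N1 N2]. unfold normal in N1, N2.
  assert (Hl := lam_0_pos (S k)).
  set (l := lam (S k) O) in *. set (q := IZR (p (S k))) in *. set (q2 := IZR (p (S (S k)))) in *.
  assert (HQ : 0 < Rpower P t ^ S n) by (apply pow_lt; exact HPt).
  assert (B1 : Rpower P t ^ S n <= q2 ^ S n) by (apply pow_incr; lra).
  assert (B2 : q2 ^ S n <= C2 ^ S n * Rpower P t ^ S n).
  { rewrite <- Rpow_mult_distr. apply pow_incr. lra. }
  set (Q := Rpower P t ^ S n) in *. set (Q2 := q2 ^ S n) in *.
  assert (HPQ : 0 < P * Q) by nra.
  split.
  - apply (Rmult_le_reg_r (P * Q)); [exact HPQ|].
    rewrite Rmult_assoc, Rinv_l, Rmult_1_r by lra.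
    assert (D1 : q * Q2 <= C * P * (C2 ^ S n * Q)) by (apply Rmult_le_compat; lra).
    assert (D2 : / spread <= l * (C * P * (C2 ^ S n * Q))).
    { eapply Rle_trans; [exact N1|]. rewrite Rmult_assoc. apply Rmult_le_compat_l; lra. }
    rewrite Rinv_mult. apply (Rmult_le_reg_r (C * C2 ^ S n)); [nra|].
    rewrite Rmult_assoc, Rinv_l by nra. lra.
  - apply (Rmult_le_reg_r (P * Q)); [exact HPQ|].
    rewrite (Rmult_assoc spread), Rinv_l by lra.
    assert (D1 : P * Q <= q * Q2) by (apply Rmult_le_compat; lra). 
    assert (l * (P * Q) <= l * (q * Q2)) by (apply Rmult_le_compat_l; lra). lra.
Qed.

Lemma exponent_pos : 0 < exponent.
Proof. unfold exponent. assert (H := pos_INR (S n)). assert (0 <= (1 + beta) ^ 2) by nra. nra. Qed.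

Lemma f_d_exponent : - f_d (S (S (S n))) beta = - exponent + INR (S (S n)).
Proof. unfold f_d, exponent. rewrite !S_INR. ring. Qed.

Lemma best_approx_exponent : exists c1 c2, 0 < c1 /\ 0 < c2 /\
  forall z, best_approx (S (S (S n))) alpha z ->
    c1 * Rpower (fnorm z) (- f_d (S (S (S n))) beta) <= Rabs (L z) * fnorm z ^ S (S n) /\
    Rabs (L z) * fnorm z ^ S (S n) <= c2 * Rpower (fnorm z) (- f_d (S (S (S n))) beta).
Proof.
  destruct lam_power as [c1 [c2 [Hc1 [Hc2 Hl]]]].
  assert (Hd := d_ge_3). assert (Hg := exponent_pos).
  (* The norm of [bv k] lies between p_k / 2 and 2 d p_k, which accounts for the bases 2 and 2d. *)
  exists (c1 * Rpower 2 (- exponent)), (c2 * Rpower (2 * d) exponent).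
  split; [apply Rmult_lt_0_compat; [exact Hc1 | apply Rpower_pos]|].
  split; [apply Rmult_lt_0_compat; [exact Hc2 | apply Rpower_pos]|].
  intros z Hz. destruct (best_approx_is_bv z Hz) as [k [e [He H]]].
  rewrite (fnorm_sign e _ _ He H), (L_sign e _ _ He H), Rabs_L_bv.
  assert (HX1 := fnorm_bv_ge k). assert (HX2 := fnorm_bv_le k). assert (Hp := p_ge_1 k).
  specialize (Hl k).
  set (X := fnorm (bv k)) in *. set (q := IZR (p k)) in *.
  rewrite f_d_exponent, Rpower_plus, Rpower_pow by lra.
  assert (HXn : 0 < X ^ S (S n)) by (apply pow_lt; lra).
  assert (Hlow : Rpower 2 (- exponent) * Rpower X (- exponent) <= Rpower q (- exponent)).
  { rewrite Rpower_mult_distr, !Rpower_Ropp by lra.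
    apply Rinv_le_contravar; [apply Rpower_pos | apply Rle_Rpower_l; lra]. }
  assert (Hup : Rpower q (- exponent) <= Rpower (2 * d) exponent * Rpower X (- exponent)).
  { rewrite !Rpower_Ropp. apply (Rmult_le_reg_r (Rpower X exponent)); [apply Rpower_pos|].
    rewrite Rmult_assoc, Rinv_l, Rmult_1_r by (apply Rgt_not_eq, Rpower_pos).
    apply (Rmult_le_reg_l (Rpower q exponent)); [apply Rpower_pos|].
    rewrite <- Rmult_assoc, Rinv_r, Rmult_1_l by (apply Rgt_not_eq, Rpower_pos).
    rewrite Rpower_mult_distr by lra. apply Rle_Rpower_l; lra. }
  split.
  - rewrite <- Rmult_assoc. apply Rmult_le_compat_r; [lra|]. nra.
  - rewrite <- Rmult_assoc. apply Rmult_le_compat_r; [lra|]. nra.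
Qed.

(** Let |z| be the norm of the first d - 1 coordinates and S j the first level with 4 d |z| <=
    p_{j+2}. Then z is too short to be anything but a multiple of [bv (S j)] unless |L z| >=
    [lam (S j) 0 / 2], which is of order p_j^(-exponent), and p_j^(1+beta) <= p_{j+1} < 4 d |z|
    turns this into a power of |z|. *)
Lemma non_multiple_exponent : exists c, 0 < c /\
  forall z, ~ multiple_of_best (S (S (S n))) alpha z ->
    c * Rpower (fnorm z) (- f_d (S (S (S n))) beta + INR (S (S n)) * beta)
      <= Rabs (L z) * fnorm z ^ S (S n).
Proof.
  destruct lam_power as [c1 [c2 [Hc1 [_ Hl]]]].
  assert (Hd := d_ge_3). assert (Hg := exponent_pos).
  set (h := exponent / (1 + beta)).
  assert (Hh : 0 < h) by (apply Rdiv_lt_0_compat; lra).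
  assert (Hexp : exponent = (1 + beta) * h) by (unfold h; field; lra).
  exists (Rmin 1 (c1 / 2 * Rpower (4 * d) (- h))).
  split.
  { apply Rmin_glb_lt; [lra|]. apply Rmult_lt_0_compat; [lra | apply Rpower_pos]. }
  intros z Hz.
  assert (Hm : Rmin 1 (c1 / 2 * Rpower (4 * d) (- h)) <= 1) by apply Rmin_l.
  assert (Hm' := Rmin_r 1 (c1 / 2 * Rpower (4 * d) (- h))).
  set (c := Rmin 1 (c1 / 2 * Rpower (4 * d) (- h))) in *.
  rewrite f_d_exponent.
  replace (- exponent + INR (S (S n)) + INR (S (S n)) * beta)
    with (- (exponent - INR (S (S n)) * beta) + INR (S (S n))) by ring.
  set (D := exponent - INR (S (S n)) * beta).
  (* In fact D - h = (n + 1) beta^2, so the exponent [h] obtained below is better than the required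
     [D]. *)
  assert (HDh : h <= D).
  { unfold D, h, exponent. rewrite !S_INR. assert (Hn := pos_INR n).
    replace (((1 + beta) + (INR n + 1) * (1 + beta) ^ 2) / (1 + beta)) with (1 + (INR n + 1) * (1 + beta)) by (field; lra).
    nra. }
  assert (Hmain : 1 <= fnorm z -> c * Rpower (fnorm z) (- D) <= Rabs (L z) ->
    c * Rpower (fnorm z) (- D + INR (S (S n))) <= Rabs (L z) * fnorm z ^ S (S n)).
  { intros H1 H2. rewrite Rpower_plus, Rpower_pow, <- Rmult_assoc by lra.
    apply Rmult_le_compat_r; [apply pow_le; lra | exact H2]. }
  assert (HR1 : forall x, 1 <= x -> Rpower x (- D) <= 1).
  { intros x Hx. rewrite <- (Rpower_O x) by lra. apply Rle_Rpower; lra. }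
  (* Only the last coordinate survives here, and it is nonzero because the zero vector is 0 times
     [bv 1]. So |L z| >= 1, which is why the constant is capped at 1. *)
  destruct (Req_dec (hnorm z) 0) as [Hz0|Hz0].
  - assert (Hzc : forall c', (c' < S (S n))%nat -> z c' = 0%Z).
    { intros c' Hc'. apply eq_IZR.
      assert (H := Rabs_le_rnorm (S (S n)) (zR z) c' Hc'). fold (hnorm z) in H. rewrite Hz0 in H.
      assert (H1 := Rabs_pos (zR z c')). unfold zR in *.
      destruct (Req_dec (IZR (z c')) 0) as [E|E]; [exact E|]. apply Rabs_pos_lt in E. lra. }
    assert (Hzn : z (S (S n)) <> 0%Z).
    { intros E. apply Hz. exists 0%Z, (bv 1). split; [apply best_approx_bv|].
      intros c' Hc'. destruct (Nat.eq_dec c' (S (S n))) as [->|]; [rewrite E | rewrite Hzc by lia]; ring. }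
    assert (Hz1 : 1 <= Rabs (IZR (z (S (S n))))) by (rewrite <- abs_IZR; apply IZR_le; lia).
    assert (HLz : L z = IZR (z (S (S n)))).
    { unfold L, Lform. rewrite (rsum_single (S (S (S n))) _ (S (S n)) ltac:(lia)).
      - rewrite alpha_last. ring.
      - intros i Hi Hne. rewrite Hzc by lia. ring. }
    assert (Hf : 1 <= fnorm z).
    { eapply Rle_trans; [exact Hz1|]. apply (Rabs_le_rnorm (S (S (S n))) (zR z)). lia. }
    apply Hmain; [exact Hf|]. rewrite HLz. specialize (HR1 _ Hf).
    assert (H := Rpower_pos (fnorm z) (- D)). nra.
  - assert (Hz1 := hnorm_pos_ge_1 z Hz0). assert (Hf := hnorm_le_fnorm z).
    destruct (exists_p_ge (hnorm z * (4 * d))) as [k0 Hk0].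
    destruct (first_index (fun k => hnorm z * (4 * d) <= IZR (p (S k))) k0 Hk0) as [k [Hk Hfirst]].
    destruct Hfirst as [->|[j [-> Hj]]].
    { rewrite p_S, p_0, r_0 in Hk. simpl in Hk. nra. }
    apply Rnot_le_lt in Hj.
    apply Hmain; [lra|].
    assert (HL : lam (S j) O / 2 <= Rabs (L z)).
    { apply Rnot_lt_le. intros HL. destruct (multiple_of_bv (S j) z Hk HL) as [a Ha].
      apply Hz. exists a, (bv (S j)). split; [apply best_approx_bv | exact Ha]. }
    eapply Rle_trans; [|exact HL].
    destruct (Hl j) as [Hl1 _]. destruct (growth j) as [G _].
    assert (Hp := p_ge_1 j).
    set (q := IZR (p j)) in *. set (X := fnorm z) in *.
    assert (Hq : Rpower X (- D) * Rpower (4 * d) (- h) <= Rpower q (- exponent)).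
    { apply Rle_trans with (Rpower X (- h) * Rpower (4 * d) (- h)).
      - apply Rmult_le_compat_r; [left; apply Rpower_pos | apply Rle_Rpower; lra].
      - rewrite Rpower_mult_distr by lra. rewrite Hexp, !Rpower_Ropp, <- Rpower_mult.
        apply Rinv_le_contravar; [apply Rpower_pos|].
        apply Rle_Rpower_l; [lra|]. split; [apply Rpower_pos|]. nra. }
    assert (HXD := Rpower_pos X (- D)).
    assert (c * Rpower X (- D) <= c1 / 2 * Rpower (4 * d) (- h) * Rpower X (- D)).
    { apply Rmult_le_compat_r; lra. }
    nra.
Qed.

End Exponents.

(** * Asymptotic directions *)

Definition scaled (k c : nat) : R := IZR (bv k c) / IZR (p k).

Lemma scaled_near k c : (c < S (S (S n)))%nat ->
  Rabs (scaled k c - unit_at (target k n) c) <= 1 / 24.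
Proof.
  intros Hc. assert (H := bv_near k c Hc). assert (Hp := p_ge_1 k). assert (He := defect_le_1 k).
  unfold scaled.
  replace (IZR (bv k c) / IZR (p k) - unit_at (target k n) c)
    with ((IZR (bv k c) - IZR (p k) * unit_at (target k n) c) * / IZR (p k)) by (field; lra).
  rewrite Rabs_mult, (Rabs_pos_eq (/ IZR (p k))) by (left; apply Rinv_0_lt_compat; lra).
  apply (Rmult_le_reg_r (IZR (p k))); [lra|]. rewrite Rmult_assoc, Rinv_l, Rmult_1_r by lra. nra.
Qed.

(** Since r_k r_{k+1} = p_{k+2} / p_k, the main terms cancel exactly and the difference is (K
    v_{k+2} + w_n) / p_{k+2}. *)
Lemma scaled_increment k c : (c < S (S (S n)))%nat ->
  Rabs (scaled (S (S k)) c - scaled k c) <= defect (S (S k)) - defect k.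
Proof.
  intros Hc. assert (Hd1 := defect_increment k). assert (Hd2 := defect_le_S (S k)).
  assert (Hp := p_ge_1 k). assert (Hp1 := p_ge_1 (S k)).
  assert (Hr := r_ge_1 k). assert (Hr1 := r_ge_1 (S k)).
  assert (Hd := d_ge_3).
  eapply Rle_trans with ((2 * IZR K + 2) / IZR (r (S k))); [|lra].
  assert (E : scaled (S (S k)) c - scaled k c =
    (IZR K * IZR (bv (S k) c) + IZR (basis k n c)) * / (IZR (p (S k)) * IZR (r (S k)))).
  { unfold scaled. rewrite (bv_S (S k)), basis_S_n2, !plus_IZR, !mult_IZR, <- bv_S.
    change (basis k (S n) c) with (bv k c). rewrite (p_S_R (S k)), (p_S_R k). field. lra. }
  rewrite E, Rabs_mult, (Rabs_pos_eq (/ _)) by (left; apply Rinv_0_lt_compat; nra).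
  apply (Rmult_le_reg_r (IZR (p (S k)) * IZR (r (S k)))); [nra|].
  rewrite Rmult_assoc, Rinv_l, Rmult_1_r by nra.
  replace ((2 * IZR K + 2) / IZR (r (S k)) * (IZR (p (S k)) * IZR (r (S k))))
    with ((2 * IZR K + 2) * IZR (p (S k))) by (field; lra).
  eapply Rle_trans; [apply Rabs_triang|].
  rewrite Rabs_mult, (Rabs_pos_eq (IZR K)) by (rewrite K_eq; lra).
  assert (H1 := bv_abs_le (S k) c Hc). assert (H2 := basis_abs_le k n c ltac:(lia) Hc).
  assert (0 <= IZR K) by (rewrite K_eq; lra). nra.
Qed.

Lemma target_parity m s : target (2 * m + s) n = target s n.
Proof. unfold target. rewrite Nat.even_add, Nat.even_mul. now destruct (Nat.even s). Qed.

Lemma scaled_limit : exists U : nat -> rvec, forall s c, (c < S (S (S n)))%nat ->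
  Un_cv (fun m => scaled (2 * m + s) c) (U s c).
Proof.
  destruct (functional_choice (fun (sc : nat * nat) l => (snd sc < S (S (S n)))%nat ->
    Un_cv (fun m => scaled (2 * m + fst sc) (snd sc)) l)) as [U HU].
  - intros [s c]. simpl fst. simpl snd.
    destruct (Nat.lt_ge_cases c (S (S (S n)))) as [Hc|Hc]; [|exists 0; lia].
    destruct (Un_cv_dominated_increments (fun m => scaled (2 * m + s) c)
      (fun m => defect (2 * m + s)) 2) as [l Hl].
    + intros m. replace (2 * S m + s)%nat with (S (S (2 * m + s))) by lia. now apply scaled_increment.
    + intros m. assert (H := scaled_near (2 * m + s) c Hc).
      assert (H1 := unit_at_bounds (target (2 * m + s) n) c).
      revert H. unfold Rabs. destruct (Rcase_abs _), (Rcase_abs _); lra.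
    + intros m. assert (H := defect_le_1 (2 * m + s)). assert (H1 := defect_nonneg (2 * m + s)).
      rewrite Rabs_pos_eq; lra.
    + now exists l.
  - exists (fun s c => U (s, c)). intros s c Hc. exact (HU (s, c) Hc).
Qed.

Lemma zdir_bv k c : zdir (S (S (S n))) (bv k) c = scaled k c / rnorm (S (S (S n))) (scaled k).
Proof.
  assert (Hp := p_ge_1 k). assert (Hf := fnorm_bv_ge k).
  assert (E : fnorm (bv k) = IZR (p k) * rnorm (S (S (S n))) (scaled k)).
  { rewrite <- (Rabs_pos_eq (IZR (p k))) at 1 by lra. rewrite <- rnorm_scal.
    apply rnorm_ext. intros i _. unfold zR, scaled. field. lra. }
  unfold zdir. change (znorm (S (S (S n))) (bv k)) with (fnorm (bv k)).
  rewrite E in *. unfold scaled at 2. field. split; [lra|]. intros Hz. rewrite Hz in Hf. lra.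
Qed.

Lemma zdir_sign (e : Z) (x z : zvec) : (e = 1 \/ e = -1)%Z ->
  (forall c, (c < S (S (S n)))%nat -> z c = (e * x c)%Z) ->
  forall c, (c < S (S (S n)))%nat -> zdir (S (S (S n))) z c = IZR e * zdir (S (S (S n))) x c.
Proof.
  intros He H c Hc. unfold zdir. change (znorm (S (S (S n))) z) with (fnorm z).
  rewrite (fnorm_sign e x z He H), H, mult_IZR by exact Hc.
  change (znorm (S (S (S n))) x) with (fnorm x). unfold Rdiv. ring.
Qed.

Lemma best_approx_sign (e : Z) k : (e = 1 \/ e = -1)%Z ->
  best_approx (S (S (S n))) alpha (fun c => (e * bv (S k) c)%Z).
Proof.
  intros He. assert (H := best_approx_bv k).
  assert (Hh : hnorm (fun c => (e * bv (S k) c)%Z) = hnorm (bv (S k))).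
  { rewrite hnorm_scal. destruct (unit_or_zero e ltac:(lia)) as [->|E]; [lia | rewrite E; ring]. }
  assert (HL := L_sign e (bv (S k)) (fun c => (e * bv (S k) c)%Z) He (fun c _ => eq_refl)).
  unfold best_approx in *.
  change (znorm_under (S (S (S n)))) with hnorm in *.
  change (Lform (S (S (S n))) alpha) with L in *. rewrite Hh, HL. exact H.
Qed.

(** The quotient |L(z)| / |z| depends only on the direction and is strictly smaller at the later
    vector. This supplies directions different from the limit, as an accumulation point demands. *)
Lemma zdir_bv_ne k : ~ veq (S (S (S n))) (zdir (S (S (S n))) (bv k)) (zdir (S (S (S n))) (bv (S (S k)))).
Proof.
  intros H.
  assert (HLd : forall j, L (bv j) / fnorm (bv j) =
    rsum (S (S (S n))) (fun c => alpha c * zdir (S (S (S n))) (bv j) c)).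
  { intros j. unfold L, Lform, Rdiv. rewrite Rmult_comm, <- rsum_scal. apply rsum_ext.
    intros c _. unfold zdir. change (znorm (S (S (S n))) (bv j)) with (fnorm (bv j)). unfold Rdiv. ring. }
  assert (E : L (bv k) / fnorm (bv k) = L (bv (S (S k))) / fnorm (bv (S (S k)))).
  { rewrite !HLd. apply rsum_ext. intros c Hc. now rewrite (H c Hc). }
  assert (H1 := fnorm_bv_ge k). assert (H2 := fnorm_bv_le k). assert (H3 := fnorm_bv_ge (S (S k))).
  assert (Hp := p_ge_1 k). assert (Hp1 := p_le_S k). assert (Hp2 := p_SS_ge k).
  assert (Hd := d_ge_3). assert (HMd := M_ge_d).
  assert (Hf : fnorm (bv k) <= fnorm (bv (S (S k)))).
  { assert (3000 * d * IZR (p k) <= IZR (p (S (S k)))) by nra. lra. }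
  apply (f_equal Rabs) in E. unfold Rdiv in E. rewrite !Rabs_mult, !Rabs_L_bv in E.
  rewrite (Rabs_pos_eq (/ fnorm (bv k))) in E by (left; apply Rinv_0_lt_compat; lra).
  rewrite (Rabs_pos_eq (/ fnorm (bv (S (S k))))) in E by (left; apply Rinv_0_lt_compat; lra).
  assert (Hl1 := lam_0_lt (S k)). assert (Hl2 := lam_0_lt (S (S k))). assert (Hl3 := lam_0_pos (S (S (S k)))).
  assert (Hi : / fnorm (bv (S (S k))) <= / fnorm (bv k)) by (apply Rinv_le_contravar; lra).
  assert (Hi0 : 0 < / fnorm (bv (S (S k)))) by (apply Rinv_0_lt_compat; lra).
  nra.
Qed.

Lemma zdir_limit : exists u : nat -> rvec,
  (forall s, rnorm (S (S (S n))) (u s) = 1) /\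
  (forall s, Un_cv (fun m => rnorm (S (S (S n)))
     (vsub (zdir (S (S (S n))) (bv (2 * m + s))) (u s))) 0) /\
  ~ veq (S (S (S n))) (u O) (u 1%nat) /\ ~ veq (S (S (S n))) (u O) (vopp (u 1%nat)).
Proof.
  destruct scaled_limit as [U HU].
  assert (Hnear : forall s c, (c < S (S (S n)))%nat -> Rabs (U s c - unit_at (target s n) c) <= 1 / 24).
  { intros s c Hc. apply (Un_cv_near (fun m => scaled (2 * m + s) c)); [|now apply HU].
    intros m. rewrite <- (target_parity m s). now apply scaled_near. }
  assert (Hpos : forall s, 0 < rnorm (S (S (S n))) (U s)).
  { intros s. assert (Ht := target_lt s n ltac:(lia)).
    apply Rlt_le_trans with (Rabs (U s (target s n))).
    - specialize (Hnear s (target s n) ltac:(lia)). unfold unit_at in Hnear. rewrite Nat.eqb_refl in Hnear.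
      revert Hnear. unfold Rabs. destruct (Rcase_abs _), (Rcase_abs _); lra.
    - apply Rabs_le_rnorm. lia. }
  exists (fun s c => U s c / rnorm (S (S (S n))) (U s)).
  split; [|split].
  - intros s. specialize (Hpos s).
    rewrite (rnorm_ext _ _ (fun c => / rnorm (S (S (S n))) (U s) * U s c)) by (intros; unfold Rdiv; ring).
    rewrite rnorm_scal, Rabs_pos_eq by (left; now apply Rinv_0_lt_compat). field. lra.
  - intros s. replace 0 with (rnorm (S (S (S n))) (fun _ => 0)).
    2: { assert (H := rnorm_le (S (S (S n))) (fun _ => 0) 0 ltac:(lra)).
         assert (H1 := rnorm_nonneg (S (S (S n))) (fun _ => 0)).
         rewrite Rmult_0_r in H. apply Rle_antisym; [|exact H1]. apply H. intros. rewrite Rabs_R0. lra. }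
    apply (Un_cv_rnorm (S (S (S n))) (fun m => vsub (zdir (S (S (S n))) (bv (2 * m + s)))
      (fun c => U s c / rnorm (S (S (S n))) (U s)))).
    intros c Hc. unfold vsub.
    rewrite <- (Rminus_diag (U s c / rnorm (S (S (S n))) (U s))).
    apply (CV_minus (fun m => zdir (S (S (S n))) (bv (2 * m + s)) c)); [|apply Un_cv_const].
    apply (Un_cv_ext (fun m => scaled (2 * m + s) c / rnorm (S (S (S n))) (scaled (2 * m + s)))).
    { intros m. symmetry. apply zdir_bv. }
    apply Un_cv_div.
    + specialize (Hpos s). lra.
    + now apply HU.
    + apply (Un_cv_rnorm (S (S (S n))) (fun m => scaled (2 * m + s))). intros i Hi. now apply HU.
  - assert (Ha := Hpos O). assert (Hb := Hpos 1%nat).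
    set (a := rnorm (S (S (S n))) (U O)) in *. set (b := rnorm (S (S (S n))) (U 1%nat)) in *.
    assert (H1 := Hnear O n ltac:(lia)). assert (H2 := Hnear O (S n) ltac:(lia)).
    assert (H3 := Hnear 1%nat n ltac:(lia)). assert (H4 := Hnear 1%nat (S n) ltac:(lia)).
    assert (T0 : target 0 n = n) by reflexivity.
    assert (T1 : target 1 n = S n) by (unfold target; simpl; now rewrite Nat.eqb_refl).
    rewrite T0 in H1, H2. rewrite T1 in H3, H4. unfold unit_at in *. rewrite Nat.eqb_refl in H1, H4.
    destruct (Nat.eqb_spec (S n) n); [lia|]. destruct (Nat.eqb_spec n (S n)); [lia|].
    (* Up to 1/24 the two limits before normalisation are different unit vectors: the first equation
       would force a >= 23 b, the second b >= 23 a. *)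
    assert (Hcross : forall e : R, e = 1 \/ e = -1 ->
      U O n / a = e * (U 1%nat n / b) -> U O (S n) / a = e * (U 1%nat (S n) / b) -> False).
    { intros e He E1 E2.
      assert (F1 : U O n * b = e * U 1%nat n * a).
      { replace (U O n * b) with (U O n / a * (a * b)) by (field; lra). rewrite E1. field. lra. }
      assert (F2 : U O (S n) * b = e * U 1%nat (S n) * a).
      { replace (U O (S n) * b) with (U O (S n) / a * (a * b)) by (field; lra). rewrite E2. field. lra. }
      assert (G1 : 23 / 24 <= U O n) by (revert H1; unfold Rabs; destruct (Rcase_abs _); lra).
      assert (G2 : - (1 / 24) <= U O (S n) <= 1 / 24) by (revert H2; unfold Rabs; destruct (Rcase_abs _); lra).
      assert (G3 : - (1 / 24) <= U 1%nat n <= 1 / 24) by (revert H3; unfold Rabs; destruct (Rcase_abs _); lra).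
      assert (G4 : 23 / 24 <= U 1%nat (S n)) by (revert H4; unfold Rabs; destruct (Rcase_abs _); lra).
      destruct He as [-> | ->]; nra. }
    split; intros E.
    + apply (Hcross 1); [now left | rewrite (E n ltac:(lia)); ring | rewrite (E (S n) ltac:(lia)); ring].
    + apply (Hcross (-1)); [now right | rewrite (E n ltac:(lia)); unfold vopp; ring |
        rewrite (E (S n) ltac:(lia)); unfold vopp; ring].
Qed.

Lemma asymptotic_directions : exists u1 u2 : rvec,
  ~ veq (S (S (S n))) u1 u2 /\ ~ veq (S (S (S n))) u1 (vopp u2) /\
  forall u, asymptotic_direction (S (S (S n))) alpha u <->
    (veq (S (S (S n))) u u1 \/ veq (S (S (S n))) u (vopp u1) \/
     veq (S (S (S n))) u u2 \/ veq (S (S (S n))) u (vopp u2)).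
Proof.
  destruct zdir_limit as [w [Hw1 [Hcv [Hne1 Hne2]]]].
  exists (w O), (w 1%nat). split; [exact Hne1|]. split; [exact Hne2|].
  assert (Hsuff : forall (s : nat) (e : Z) (u : rvec), (e = 1 \/ e = -1)%Z ->
    veq (S (S (S n))) u (fun c => IZR e * w s c) -> asymptotic_direction (S (S (S n))) alpha u).
  { intros s e u He Hu.
    assert (He1 : Rabs (IZR e) = 1) by (destruct (unit_or_zero e ltac:(lia)) as [->|E]; [lia | exact E]).
    split.
    { rewrite (rnorm_ext _ _ _ Hu), rnorm_scal, Hw1, He1. ring. }
    intros eps Heps. destruct (Hcv s eps Heps) as [N HN].
    assert (Hdist : forall m, (N <= m)%nat ->
      rnorm (S (S (S n))) (vsub (zdir (S (S (S n))) (fun c => (e * bv (2 * m + s) c)%Z)) u) < eps).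
    { intros m Hm. specialize (HN m Hm). unfold Rdist in HN.
      rewrite Rminus_0_r, Rabs_pos_eq in HN by apply rnorm_nonneg.
      eapply Rle_lt_trans; [|exact HN]. right.
      rewrite <- (Rmult_1_l (rnorm _ (vsub _ (w s)))), <- He1, <- rnorm_scal.
      apply rnorm_ext. intros c Hc. unfold vsub.
      rewrite (zdir_sign e (bv (2 * m + s)) _ He (fun _ _ => eq_refl) c Hc), (Hu c Hc). ring. }
    (* If this direction happens to equal u, the next one of the same parity does not, by
       [zdir_bv_ne]. *)
    destruct (classic (veq (S (S (S n))) (zdir (S (S (S n))) (fun c => (e * bv (2 * S N + s) c)%Z)) u)) as [E1|E1].
    - destruct (classic (veq (S (S (S n))) (zdir (S (S (S n))) (fun c => (e * bv (2 * S (S N) + s) c)%Z)) u)) as [E2|E2].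
      + exfalso. apply (zdir_bv_ne (2 * S N + s)). intros c Hc.
        specialize (E1 c Hc). specialize (E2 c Hc).
        rewrite (zdir_sign e (bv (2 * S N + s)) _ He (fun _ _ => eq_refl) c Hc) in E1.
        rewrite (zdir_sign e (bv (2 * S (S N) + s)) _ He (fun _ _ => eq_refl) c Hc) in E2.
        replace (S (S (2 * S N + s))) with (2 * S (S N) + s)%nat by lia.
        destruct He as [-> | ->]; lra.
      + exists (fun c => (e * bv (2 * S (S N) + s) c)%Z). split; [|split; [exact E2 | apply Hdist; lia]].
        replace (2 * S (S N) + s)%nat with (S (2 * N + 3 + s)) by lia. now apply best_approx_sign.
    - exists (fun c => (e * bv (2 * S N + s) c)%Z). split; [|split; [exact E1 | apply Hdist; lia]].
      replace (2 * S N + s)%nat with (S (2 * N + 1 + s)) by lia. now apply best_approx_sign. }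
  intros u. split.
  2: { intros [Hu|[Hu|[Hu|Hu]]].
       - apply (Hsuff O 1%Z); [now left|]. intros c Hc. rewrite (Hu c Hc). ring.
       - apply (Hsuff O (-1)%Z); [now right|]. intros c Hc. rewrite (Hu c Hc). unfold vopp. ring.
       - apply (Hsuff 1%nat 1%Z); [now left|]. intros c Hc. rewrite (Hu c Hc). ring.
       - apply (Hsuff 1%nat (-1)%Z); [now right|]. intros c Hc. rewrite (Hu c Hc). unfold vopp. ring. }
  intros [_ Hu]. apply NNPP. intros Hno.
  set (sgn := fun e : Z => fun x : rvec => fun c => IZR e * x c).
  assert (Hgap : forall e : Z, exists g, 0 < g /\ forall j, (j < 2)%nat ->
     ~ veq (S (S (S n))) (sgn e (w j)) u -> exists c, (c < S (S (S n)))%nat /\ g <= Rabs (sgn e (w j) c - u c)).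
  { intros e. apply finite_gap. }
  destruct (Hgap 1%Z) as [g1 [Hg1 G1]]. destruct (Hgap (-1)%Z) as [g2 [Hg2 G2]]. clear Hgap.
  set (g := Rmin g1 g2). assert (Hg : 0 < g) by now apply Rmin_glb_lt.
  assert (Hgl := Rmin_l g1 g2). assert (Hgr := Rmin_r g1 g2). fold g in Hgl, Hgr.
  assert (HG : forall (e : Z) j, (e = 1 \/ e = -1)%Z -> (j < 2)%nat ->
     exists c, (c < S (S (S n)))%nat /\ g <= Rabs (IZR e * w j c - u c)).
  { intros e j He Hj.
    assert (Hv : ~ veq (S (S (S n))) (sgn e (w j)) u).
    { intros E. apply Hno. assert (j = 0 \/ j = 1)%nat as [-> | ->] by lia; destruct He as [-> | ->].
      - left. intros c Hc. rewrite <- (E c Hc). unfold sgn. ring.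
      - right; left. intros c Hc. rewrite <- (E c Hc). unfold sgn, vopp. ring.
      - right; right; left. intros c Hc. rewrite <- (E c Hc). unfold sgn. ring.
      - right; right; right. intros c Hc. rewrite <- (E c Hc). unfold sgn, vopp. ring. }
    destruct He as [-> | ->].
    - destruct (G1 j Hj Hv) as [c [Hc H]]. exists c. split; [exact Hc|]. unfold sgn in H. lra.
    - destruct (G2 j Hj Hv) as [c [Hc H]]. exists c. split; [exact Hc|]. unfold sgn in H. lra. }
  destruct (Hcv O (g / 2) ltac:(lra)) as [N0 HN0]. destruct (Hcv 1%nat (g / 2) ltac:(lra)) as [N1 HN1].
  set (J := (2 * (N0 + N1))%nat).
  assert (Hfar : forall k, (J <= k)%nat -> exists s, (s < 2)%nat /\ forall c, (c < S (S (S n)))%nat ->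
     Rabs (zdir (S (S (S n))) (bv k) c - w s c) < g / 2).
  { intros k Hk. assert (Hmod := Nat.div_mod_eq k 2). assert (Hlt := Nat.mod_upper_bound k 2 ltac:(lia)).
    assert (Hdiv : (N0 + N1 <= k / 2)%nat) by (unfold J in Hk; lia).
    exists (k mod 2)%nat. split; [exact Hlt|]. intros c Hc.
    assert (Hn : rnorm (S (S (S n))) (vsub (zdir (S (S (S n))) (bv k)) (w (k mod 2)%nat)) < g / 2).
    { rewrite Hmod at 1. assert (k mod 2 = 0 \/ k mod 2 = 1)%nat as [E|E] by lia; rewrite E.
      - specialize (HN0 (k / 2)%nat ltac:(lia)). unfold Rdist in HN0.
        now rewrite Rminus_0_r, Rabs_pos_eq in HN0 by apply rnorm_nonneg.
      - specialize (HN1 (k / 2)%nat ltac:(lia)). unfold Rdist in HN1.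
        now rewrite Rminus_0_r, Rabs_pos_eq in HN1 by apply rnorm_nonneg. }
    eapply Rle_lt_trans; [|exact Hn].
    apply (Rabs_le_rnorm (S (S (S n))) (vsub (zdir (S (S (S n))) (bv k)) (w (k mod 2)%nat)) c Hc). }
  assert (Hclose : forall e : Z, exists h, 0 < h /\ forall j, (j < J)%nat ->
     ~ veq (S (S (S n))) (sgn e (zdir (S (S (S n))) (bv j))) u ->
     exists c, (c < S (S (S n)))%nat /\ h <= Rabs (sgn e (zdir (S (S (S n))) (bv j)) c - u c)).
  { intros e. apply (finite_gap (S (S (S n))) J (fun j => sgn e (zdir (S (S (S n))) (bv j)))). }
  destruct (Hclose 1%Z) as [h1 [Hh1 C1]]. destruct (Hclose (-1)%Z) as [h2 [Hh2 C2]]. clear Hclose.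
  (* From index [J] on, all directions are within g/2 of a limit, up to sign, hence at least g/2
     from u in some coordinate; the earlier ones differ from u by [h1] or [h2] in some coordinate,
     unless they equal u. *)
  set (eps := Rmin (g / 2) (Rmin h1 h2)).
  assert (Heps : 0 < eps) by (apply Rmin_glb_lt; [lra | now apply Rmin_glb_lt]).
  assert (Hel := Rmin_l (g / 2) (Rmin h1 h2)). assert (Her := Rmin_r (g / 2) (Rmin h1 h2)).
  assert (Hhl := Rmin_l h1 h2). assert (Hhr := Rmin_r h1 h2). fold eps in Hel, Her.
  destruct (Hu eps Heps) as [z [Hz [Hzne Hzd]]].
  destruct (best_approx_is_bv z Hz) as [k [e [He H]]].
  assert (Hdir := zdir_sign e _ _ He H).
  assert (Hzc : forall c, (c < S (S (S n)))%nat -> Rabs (IZR e * zdir (S (S (S n))) (bv k) c - u c) < eps).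
  { intros c Hc. rewrite <- Hdir by exact Hc. eapply Rle_lt_trans; [|exact Hzd].
    apply (Rabs_le_rnorm (S (S (S n))) (vsub (zdir (S (S (S n))) z) u) c Hc). }
  destruct (Nat.lt_ge_cases k J) as [Hk|Hk].
  - assert (Hv : ~ veq (S (S (S n))) (sgn e (zdir (S (S (S n))) (bv k))) u).
    { intros E. apply Hzne. intros c Hc. rewrite (Hdir c Hc). apply (E c Hc). }
    destruct He as [-> | ->].
    + destruct (C1 k Hk Hv) as [c [Hc Hcc]]. specialize (Hzc c Hc). unfold sgn in Hcc. lra.
    + destruct (C2 k Hk Hv) as [c [Hc Hcc]]. specialize (Hzc c Hc). unfold sgn in Hcc. lra.
  - destruct (Hfar k Hk) as [s [Hs Hsc]]. destruct (HG e s He Hs) as [c [Hc Hgc]].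
    specialize (Hzc c Hc). specialize (Hsc c Hc).
    assert (Rabs (IZR e * w s c - u c) < g); [|lra].
    replace (IZR e * w s c - u c) with
      ((IZR e * zdir (S (S (S n))) (bv k) c - u c) + - (IZR e * (zdir (S (S (S n))) (bv k) c - w s c))) by ring.
    eapply Rle_lt_trans; [apply Rabs_triang|]. rewrite Rabs_Ropp, Rabs_mult.
    destruct (unit_or_zero e ltac:(lia)) as [->|E]; [lia|]. rewrite E. lra.
Qed.

End Functional.

(** * Existence of the form *)

Lemma prescribed_values k (x : nat -> R) :
  exists alpha : rvec, forall i, (i < S (S (S n)))%nat -> L alpha (basis k i) = x i.
Proof.
  revert x. induction k as [|k IH]; intros x.
  - exists (fun c => if (c =? S (S n))%nat then x O else x (S c)). intros i Hi. unfold L, Lform.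
    destruct i as [|i].
    + rewrite (rsum_single (S (S (S n))) _ (S (S n)) ltac:(lia)).
      * cbn [basis]. rewrite Nat.eqb_refl. ring.
      * intros c _ Hc. cbn [basis]. destruct (Nat.eqb_spec c (S (S n))); [lia | ring].
    + rewrite (rsum_single (S (S (S n))) _ i ltac:(lia)).
      * cbn [basis]. rewrite Nat.eqb_refl. destruct (Nat.eqb_spec i (S (S n))); [lia | ring].
      * intros c _ Hc. cbn [basis]. destruct (Nat.eqb_spec c i); [lia | ring].
  - set (g := nat_rect (fun _ => R)
      (x (S (S n)) - IZR (r k) * IZR (r (S k)) * x O - IZR K * x (S n))
      (fun j v => IZR (r (S k)) * v - x (n - j)%nat)).
    destruct (IH (fun i => if (i =? S n)%nat then x O else if (i =? S (S n))%nat then x (S n)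
                           else g (n - i)%nat)) as [alpha Halpha].
    exists alpha. intros i Hi. destruct i as [|i].
    + rewrite (L_ext _ _ (basis k (S n))) by reflexivity.
      rewrite Halpha by lia. now rewrite Nat.eqb_refl.
    + destruct (Nat.eq_dec i n) as [->|Hin].
      { rewrite (L_ext _ _ (basis k (S (S n)))) by (intros; apply basis_S_n1).
        rewrite Halpha by lia. destruct (Nat.eqb_spec (S (S n)) (S n)); [lia|].
        now rewrite Nat.eqb_refl. }
      destruct (Nat.eq_dec i (S n)) as [->|Hin'].
      { rewrite (L_lin alpha (IZR (r k) * IZR (r (S k))) (IZR K) 1
          (basis k (S n)) (basis k (S (S n))) (basis k n)).
        2: { intros c _. rewrite basis_S_n2, !plus_IZR, !mult_IZR. ring. }
        rewrite !Halpha by lia. rewrite !Nat.eqb_refl.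
        destruct (Nat.eqb_spec (S (S n)) (S n)), (Nat.eqb_spec n (S n)), (Nat.eqb_spec n (S (S n))); try lia.
        rewrite Nat.sub_diag. unfold g. simpl. ring. }
      rewrite (L_lin alpha (IZR (r (S k))) (-1) 0 (basis k (S i)) (basis k i) (basis k i)).
      2: { intros c _. rewrite basis_S_mid by lia. rewrite minus_IZR, mult_IZR. ring. }
      rewrite !Halpha by lia.
      destruct (Nat.eqb_spec (S i) (S n)), (Nat.eqb_spec (S i) (S (S n))),
        (Nat.eqb_spec i (S n)), (Nat.eqb_spec i (S (S n))); try lia.
      replace (n - i)%nat with (S (n - S i)) by lia.
      change (g (S (n - S i))) with (IZR (r (S k)) * g (n - S i)%nat - x (n - (n - S i))%nat).
      replace (n - (n - S i))%nat with (S i) by lia. ring.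
Qed.

Lemma cone_downward (alpha : rvec) (N : nat) : cone alpha N -> forall k, (k <= N)%nat -> cone alpha k.
Proof.
  induction N as [|N IH]; intros HN k Hk.
  - now replace k with O by lia.
  - destruct (Nat.eq_dec k (S N)) as [->|]; [exact HN|].
    apply IH; [now apply cone_step | lia].
Qed.

Lemma lam_0_antitone (alpha : rvec) (N : nat) : cone alpha N -> lam alpha N O <= lam alpha O O.
Proof.
  induction N as [|N IH]; intros HN; [lra|].
  assert (HN' : cone alpha N) by now apply cone_step.
  specialize (IH HN'). destruct (HN' (S n) ltac:(lia)) as [_ H]. rewrite lam_n1 in H. lra.
Qed.

Lemma Rabs_lam_0 (alpha : rvec) c : (c < S (S (S n)))%nat ->
  exists i, (i < S (S (S n)))%nat /\ Rabs (alpha c) = Rabs (lam alpha O i).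
Proof.
  intros Hc. exists (if (c =? S (S n))%nat then O else S c). split.
  { destruct (Nat.eqb_spec c (S (S n))); lia. }
  rewrite <- Rabs_L_basis. f_equal. unfold L, Lform.
  rewrite (rsum_single (S (S (S n))) _ c Hc).
  - destruct (Nat.eqb_spec c (S (S n))) as [->|]; cbn [basis]; rewrite Nat.eqb_refl; ring.
  - intros i _ Hi. destruct (Nat.eqb_spec c (S (S n))) as [->|]; cbn [basis].
    + destruct (Nat.eqb_spec i (S (S n))); [lia | ring].
    + destruct (Nat.eqb_spec i c); [lia | ring].
Qed.

(** The witness is, up to sign and scale, the form dual to v_N, which vanishes on the rest of the
    basis at level N. As [lam] at index 0 does not increase with the level, it is at least 1 at
    level 0, and division by it makes the last coordinate 1. *)
Lemma finite_cone (N : nat) : exists alpha : rvec, alpha (S (S n)) = 1 /\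
  (forall c, (c < S (S (S n)))%nat -> Rabs (alpha c) <= 1) /\ forall k, (k <= N)%nat -> cone alpha k.
Proof.
  destruct (prescribed_values N (fun i => if (i =? 0)%nat then (-1) ^ N else 0)) as [a Ha].
  assert (Hlam : forall i, (i < S (S (S n)))%nat -> lam a N i = if (i =? 0)%nat then 1 else 0).
  { intros i Hi. unfold lam. rewrite Ha by exact Hi.
    destruct (Nat.eqb_spec i 0) as [->|]; [|ring].
    change (0 =? S n)%nat with false. cbv iota. rewrite Rmult_1_r, <- Rpow_mult_distr.
    replace (-1 * -1) with 1 by ring. apply pow1. }
  assert (HN : cone a N).
  { intros i Hi. rewrite !Hlam by lia. simpl. destruct (i =? 0)%nat; lra. }
  assert (H0 := lam_0_antitone a N HN). rewrite (Hlam O) in H0 by lia. simpl in H0.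
  set (s := lam a O O) in *.
  assert (Hinv : 0 < / s) by (apply Rinv_0_lt_compat; lra).
  assert (Hscale : forall k i, lam (fun c => / s * a c) k i = / s * lam a k i).
  { intros k i. unfold lam.
    assert (L (fun c => / s * a c) (basis k i) = / s * L a (basis k i)) as ->; [|ring].
    unfold L, Lform. rewrite <- rsum_scal. apply rsum_ext. intros. ring. }
  assert (Hcone : forall k, (k <= N)%nat -> cone (fun c => / s * a c) k).
  { intros k Hk i Hi. rewrite !Hscale. destruct (cone_downward a N HN k Hk i Hi). nra. }
  assert (Hs : lam (fun c => / s * a c) O O = 1) by (rewrite Hscale; fold s; field; lra).
  exists (fun c => / s * a c). split; [|split; [|exact Hcone]].
  - exact (eq_trans (eq_sym (lam_0_0 (fun c => / s * a c))) Hs).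
  - intros c Hc. destruct (Rabs_lam_0 (fun c => / s * a c) c Hc) as [i [Hi E]]. rewrite E.
    destruct (Hcone O ltac:(lia) i Hi) as [H1 H2]. rewrite Hs in H2. rewrite Rabs_pos_eq; lra.
Qed.

(** Each level's inequalities hold for all but finitely many of the forms from [finite_cone], and
    [lam k i] is continuous in the form, so a subsequential limit satisfies them all. *)
Lemma exists_cone : exists alpha : rvec, alpha (S (S n)) = 1 /\ forall k, cone alpha k.
Proof.
  destruct (functional_choice _ finite_cone) as [a Ha].
  destruct (bounded_subsequence_vec (S (S (S n))) a 1) as [phi [y [Hphi Hy]]].
  { intros N i Hi. now apply Ha. }
  exists y. split.
  - apply (UL_sequence (fun N => a (phi N) (S (S n)))); [apply Hy; lia|].
    apply (Un_cv_ext (fun _ => 1)); [intros N; symmetry; apply Ha | apply Un_cv_const].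
  - assert (Hlam : forall k i, Un_cv (fun N => lam (a (phi N)) k i) (lam y k i)).
    { intros k i. unfold lam.
      apply (CV_mult (fun _ => _)); [apply Un_cv_const|].
      apply (Un_cv_rsum (S (S (S n))) (fun N c => a (phi N) c * IZR (basis k i c))).
      intros c Hc. apply (CV_mult (fun N => a (phi N) c)); [now apply Hy | apply Un_cv_const]. }
    assert (Hc : forall k N, (k <= N)%nat -> cone (a (phi N)) k).
    { intros k N Hk. apply Ha. specialize (Hphi N). lia. }
    intros k i Hi. split.
    + apply (Un_cv_nonneg (fun N => lam (a (phi N)) k i) _ k); [|apply Hlam].
      intros N HN. now apply Hc.
    + apply Rge_le, Rminus_ge, Rle_ge.
      apply (Un_cv_nonneg (fun N => lam (a (phi N)) k O - lam (a (phi N)) k i) _ k).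
      * intros N HN. destruct (Hc k N HN i Hi). lra.
      * apply (CV_minus (fun N => lam (a (phi N)) k O) (fun N => lam (a (phi N)) k i)); apply Hlam.
Qed.

End Basis.

Theorem theorem2 (d : nat) (beta : R) :
  (3 <= d)%nat -> 0 < beta ->
  exists alpha : rvec, in_pi d alpha /\
    (* (i) *)
    (exists c1 c2 : R, 0 < c1 /\ 0 < c2 /\
       forall z : zvec, best_approx d alpha z ->
         c1 * Rpower (znorm d z) (- f_d d beta)
           <= Rabs (Lform d alpha z) * znorm d z ^ (d - 1) /\
         Rabs (Lform d alpha z) * znorm d z ^ (d - 1)
           <= c2 * Rpower (znorm d z) (- f_d d beta)) /\
    (* (ii) *)
    (exists c : R, 0 < c /\
       forall z : zvec, ~ multiple_of_best d alpha z ->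
         c * Rpower (znorm d z) (- f_d d beta + INR (d - 1) * beta)
           <= Rabs (Lform d alpha z) * znorm d z ^ (d - 1)) /\
    (* (iii) *)
    (exists u1 u2 : rvec,
       ~ veq d u1 u2 /\ ~ veq d u1 (vopp u2) /\
       forall u : rvec, asymptotic_direction d alpha u <->
         (veq d u u1 \/ veq d u (vopp u1) \/ veq d u u2 \/ veq d u (vopp u2))).
Proof.
  intros Hd Hbeta. destruct d as [|[|[|n]]]; [lia | lia | lia |].
  destruct (growth_sequence beta (1000 * INR (S (S (S n))) ^ 2) Hbeta)
    as [M [p [r [C [HM [Hp0 [Hr0 [HpS [HrS [HC Hgrowth]]]]]]]]]].
  set (K := (16 * Z.of_nat (S (S (S n))))%Z).
  assert (HK : IZR K = 16 * INR (S (S (S n)))) by (unfold K; now rewrite mult_IZR, <- INR_IZR_INZ).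
  destruct (exists_cone n K M r Hr0 HrS HK HM) as [alpha [Halpha Hcone]].
  exists alpha. split; [exact Halpha|]. split; [|split].
  - exact (best_approx_exponent n K M p r Hp0 Hr0 HpS HrS HK HM alpha Halpha Hcone beta C Hbeta HC Hgrowth).
  - exact (non_multiple_exponent n K M p r Hp0 Hr0 HpS HrS HK HM alpha Halpha Hcone beta C Hbeta HC Hgrowth).
  - exact (asymptotic_directions n K M p r Hp0 Hr0 HpS HrS HK HM alpha Halpha Hcone).
Qed.
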